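(* Let $X_1,\ldots, X_n$ be iid random matrices taking values in $\mathcal{S}_d$ with mean matrix $\mathbb{E}X_1 = M$ and matrix-valued moment generating function $G(\gamma) = \mathbb{E}e^{\gamma(X_1 - M)}$, and let $U$ be a super-uniform random matrix taking values in $\mathcal{S}_d^{+}$, independent of all the $X_i$. Let $\overline{X}_n := \frac{1}{n}(X_1 +\cdots+X_n)$. Then for any $\gamma, \beta>0$, $$\mathbb{P}\left(e^{\gamma (\overline{X}_n-M)} \succeq \beta U\right) \leq \frac{1}{\beta d} \operatorname{tr}\left(e^{n\log G(\gamma/n)}\right).$$
   Context: $\mathcal{S}_d$ denotes the set of $d\times d$ real symmetric matrices and $\mathcal{S}_d^{+}$ the positive semidefinite ones. The Loewner order: for $A,B\in\mathcal{S}_d$, $A \preceq B$ (equivalently $B\succeq A$) means $B-A$ is positive semidefinite. An $\mathcal{S}_d^{+}$-valued random matrix $U$ is called super-uniform if $\mathbb{P}(U \preceq Z) \leq \operatorname{tr}(Z)/d$ for all (deterministic) $Z \in \mathcal{S}_d^{+}$. The exponential of a symmetric matrix and the logarithm of a positive definite matrix are defined through the eigenvalues in an orthogonal diagonalization. Iid means independent and identically distributed. Expectations of random matrices are entrywise and are assumed to exist (finite) when written. *)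

(* Defs.v *)
From HB Require Import structures.
From mathcomp Require Import all_boot all_order all_algebra.
From mathcomp Require Import all_classical all_reals all_analysis.

Set Implicit Arguments.
Unset Strict Implicit.
Unset Printing Implicit Defensive.

Import Order.TTheory GRing.Theory Num.Theory.
Import numFieldNormedType.Exports.

Local Open Scope classical_set_scope.
Local Open Scope ring_scope.

Section symmetric_matrices.
Context {R : realType} {d : nat}.
Implicit Types (A B Q : 'M[R]_d) (D : 'rV[R]_d).

Definition psdmx A : Prop :=
  A \is symmetricmx /\ forall x : 'rV[R]_d, 0 <= (x *m A *m x^T) 0 0.

Definition loewner_le A B : Prop := psdmx (B - A).

(* The rows of Q form an orthonormal eigenbasis of A, with eigenvalues D. *)
Definition orthodiag A (QD : 'M[R]_d * 'rV[R]_d) : Prop :=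
  QD.1 *m QD.1^T = 1%:M /\ A = QD.1^T *m diag_mx QD.2 *m QD.1.

(* The value does not depend on the diagonalization picked (see mxfunE); it is
   meaningful only when A has one, i.e., when A is symmetric. *)
Definition mxfun (f : R -> R) A : 'M[R]_d :=
  let QD := xget (1%:M, 0) (orthodiag A) in
  QD.1^T *m diag_mx (map_mx f QD.2) *m QD.1.

Lemma mxfunE f A Q D : orthodiag A (Q, D) ->
  mxfun f A = Q^T *m diag_mx (map_mx f D) *m Q.
Proof.
move=> /[dup] AQD; rewrite /mxfun; case: xgetP => [[Q' D'] _ AQD'|/(_ (Q, D))//].
case: AQD => /= QQ AE; case: AQD' => /= QQ' AE' _.
have QQT := mulmx1C QQ; have QQT' := mulmx1C QQ'.
pose W := Q *m Q'^T.
have WD : W *m diag_mx D' = diag_mx D *m W.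
  have : Q *m A *m Q'^T = Q *m A *m Q'^T by [].
  rewrite {1}AE' AE /W !mulmxA QQ mul1mx => <-.
  by rewrite -[in RHS]mulmxA QQ' mulmx1.
have WfD : W *m diag_mx (map_mx f D') = diag_mx (map_mx f D) *m W.
  apply/matrixP => i j; move/matrixP: WD => /(_ i j).
  rewrite !mul_mx_diag !mul_diag_mx !mxE mulrC => /eqP.
  rewrite -subr_eq0 -mulrBl mulf_eq0 subr_eq0 => /orP[/eqP ->|/eqP ->].
    by rewrite mulrC.
  by rewrite mul0r mulr0.
have WQ : Q^T *m W = Q'^T by rewrite /W mulmxA QQT mul1mx.
have WQ' : W *m Q' = Q by rewrite /W -mulmxA QQT' mulmx1.
by clearbody W; rewrite -WQ -!mulmxA (mulmxA W) WfD -mulmxA WQ'.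
Qed.

Definition expmx : 'M[R]_d -> 'M[R]_d := mxfun expR.

Definition logmx : 'M[R]_d -> 'M[R]_d := mxfun (@ln R).

End symmetric_matrices.

(* Matrices carry the sigma-algebra generated by the entries, i.e., the Borel
   sigma-algebra of R^(m x n). *)
Section measurable_matrix.
Context {R : realType} (m n : nat).

Definition mx_entry (ij : 'I_m * 'I_n) (A : 'M[R]_(m, n)) : R := A ij.1 ij.2.

Definition measurable_mx : set (set 'M[R]_(m, n)) :=
  <<s \bigcup_ij preimage_set_system setT (mx_entry ij) measurable >>.

Let measurable_mx0 : measurable_mx set0.
Proof. exact: sigma_algebra0. Qed.

Let measurable_mxC A : measurable_mx A -> measurable_mx (~` A).
Proof. by move=> mA; rewrite -setTD; exact: sigma_algebraCD. Qed.

Let measurable_mx_bigcup (F : (set 'M[R]_(m, n))^nat) :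
  (forall i, measurable_mx (F i)) -> measurable_mx (\bigcup_i F i).
Proof. exact: sigma_algebra_bigcup. Qed.

HB.instance Definition _ := @isMeasurable.Build default_measure_display
  'M[R]_(m, n) measurable_mx measurable_mx0 measurable_mxC measurable_mx_bigcup.

End measurable_matrix.

Definition mutually_independent (R : realType) (dT dE : measure_display)
    (T : measurableType dT) (E : measurableType dE) (P : probability T R)
    (I : finType) (Y : I -> {RV P >-> E}) : Prop :=
  forall (J : {set I}) (B : I -> set E), (forall i, measurable (B i)) ->
  P (\bigcap_(i in [set` J]) (Y i @^-1` B i)) =
  (\prod_(i in J) P (Y i @^-1` B i))%E.

Definition identically_distributed (R : realType) (dT dE : measure_display)
    (T : measurableType dT) (E : measurableType dE) (P : probability T R)
    (I : finType) (Y : I -> {RV P >-> E}) : Prop :=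
  forall (i j : I) (B : set E), measurable B ->
  distribution P (Y i) B = distribution P (Y j) B.

Definition iid (R : realType) (dT dE : measure_display)
    (T : measurableType dT) (E : measurableType dE) (P : probability T R)
    (I : finType) (Y : I -> {RV P >-> E}) : Prop :=
  mutually_independent Y /\ identically_distributed Y.

Section random_matrices.
Context {R : realType} {dT : measure_display} {T : measurableType dT}.
Context {d : nat} (P : probability T R).

Definition mx_integrable (Y : T -> 'M[R]_d) : Prop :=
  forall i j, P.-integrable setT (fun w => (Y w i j)%:E).

(* Meaningful under mx_integrable: fine sends infinite values to 0. *)
Definition mx_expectation (Y : T -> 'M[R]_d) : 'M[R]_d :=
  \matrix_(i, j) fine 'E_P[fun w => Y w i j].

Definition centered_mgf (X : T -> 'M[R]_d) (M : 'M[R]_d) (g : R) : 'M[R]_d :=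
  mx_expectation (fun w => expmx (g *: (X w - M))).

Definition super_uniform (U : T -> 'M[R]_d) : Prop :=
  (forall w, psdmx (U w)) /\
  forall Z : 'M[R]_d, psdmx Z ->
    (P [set w | loewner_le (U w) Z] <= (\tr Z / d%:R)%:E)%E.

End random_matrices.

(* Main.v *)
Require Import Defs.
From mathcomp Require Import all_boot all_order all_algebra.
From mathcomp Require Import all_classical all_reals all_analysis.
From mathcomp Require Import complex.
From mathcomp Require Import measurable_realfun.
From mathcomp Require Import ring lra.

Set Implicit Arguments.
Unset Strict Implicit.
Unset Printing Implicit Defensive.

Import Order.TTheory GRing.Theory Num.Theory.
Import numFieldNormedType.Exports.

Local Open Scope classical_set_scope.
Local Open Scope ring_scope.

(* As [U] is super-uniform and independent of [V = expmx (gamma (Xbar - M))],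
   conditioning on [V] bounds the probability by [E (\tr V) / (beta d)].  The
   factors of [V] are then replaced one at a time by their expectation [G]:
   for symmetric [H], [E (\tr (exp (H + Y))) <= \tr (exp (H + log (E (exp Y))))],
   which is Jensen's inequality for Lieb's concave function
   [A |-> \tr (exp (H + log A))].

   Lieb's theorem is derived, following Tropp, from the joint convexity of the
   relative entropy [D (X; A) = \tr (X log X - X log A - X + A)].  In eigenbases
   of [A] and [X], with [c] the matrix of scalar products of eigenvectors,
     [D (X; A) = \int_0^1 (1 - s) \sum_ij c_ij^2 (x_j - a_i)^2
                                  / ((1 - s) a_i + s x_j) ds],
   and for each [s] the integrand is a supremum over matrices [W] of functions
   that are affine in [(X, A)].  Fixing the optimal [W] at a point [(X0, A0)]
   and integrating gives an affine minorant of [D] that is tight at that point;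
   its slope in [X] must be [log X0 - log A0], and with [X = exp (H + log A)]
   the minorant becomes a linear majorant of Lieb's function. *)

(** * Spectral theorem for real symmetric matrices *)

Lemma symmetricmxP (R : realType) d (A : 'M[R]_d) :
  reflect (A^T = A) (A \is symmetricmx).
Proof.
rewrite is_hermitianmxE expr0 scale1r map_mx_id// eq_sym.
exact: eqP.
Qed.

(** Over the complex numbers the matrix is Hermitian, so its spectral values are real; being roots
    of the characteristic polynomial, they are eigenvalues over [R] already. *)
Lemma symmetric_eigenvector (R : realType) n (A : 'M[R]_n.+1) : A^T = A ->
  exists (l : R) (v : 'rV_n.+1), v *m A = l *: v /\ v *m v^T = 1%:M.
Proof.
move=> At.
pose AC := map_mx (real_complex R) A.
have ACreal : AC \is a mxOver Num.real.
  by apply/mxOverP => i j; rewrite mxE complex_real.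
have ACsym : AC \is symmetricmx.
  by rewrite is_hermitianmxE expr0 scale1r map_mx_id// map_trmx At.
have AChs := realsym_hermsym ACsym ACreal.
have /mxOverP/(_ 0 0) Dr := hermitian_spectral_diag_real AChs.
have /hermitian_normalmx/orthomx_spectralP ACE := AChs.
pose P := spectralmx AC; pose D := spectral_diag AC.
have : eigenvalue AC (D 0 0).
  apply/eigenvalueP; exists (row 0 P).
    rewrite {1}ACE -row_mul !mulmxA mulmxV ?spectral_unit// mul1mx.
    by rewrite row_mul row_diag_mx -scalemxAl -rowE.
  have /row_freeP[Z PZ] : row_free P by rewrite row_free_unit spectral_unit.
  apply/eqP => r0; have : row 0 (P *m Z) = 0 by rewrite row_mul r0 mul0mx.
  by rewrite PZ row1 => /matrixP/(_ 0 0); rewrite !mxE eqxx => /eqP; rewrite oner_eq0.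
rewrite -/D in Dr; have /complex_realP[l ->] := Dr.
rewrite eigenvalue_root_char -map_char_poly fmorph_root -eigenvalue_root_char.
move=> /eigenvalueP[v vA v0]; exists l.
have vv : v *m v^T = (\sum_i v 0 i ^+ 2)%:M.
  by rewrite [LHS]mx11_scalar mxE; congr _%:M; apply: eq_bigr => i _; rewrite mxE.
have vv0 : 0 < \sum_i v 0 i ^+ 2.
  rewrite lt_neqAle sumr_ge0 ?andbT//; last by move=> i _; exact: sqr_ge0.
  apply: contra v0 => /eqP/esym/eqP.
  rewrite psumr_eq0; last by move=> i _; exact: sqr_ge0.
  move=> /allP v0; apply/eqP/rowP => i; rewrite mxE; apply/eqP.
  by have := v0 i (mem_index_enum _); rewrite sqrf_eq0.
exists ((Num.sqrt (\sum_i v 0 i ^+ 2))^-1 *: v); split.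
  by rewrite -scalemxAl vA !scalerA mulrC.
rewrite linearZ/= -scalemxAl -scalemxAr vv scalerA scale_scalar_mx.
congr _%:M; rewrite -invfM -expr2 sqr_sqrtr ?ltW// mulVf//.
exact: lt0r_neq0.
Qed.

(* Householder reflection exchanging [e_0] and the unit vector [v]. *)
Lemma orthogonal_completion (R : realType) n (v : 'rV[R]_n.+1) :
  v *m v^T = 1%:M -> exists Q : 'M[R]_n.+1, Q *m Q^T = 1%:M /\ row 0 Q = v.
Proof.
move=> vv; pose e : 'rV[R]_n.+1 := delta_mx 0 0.
have ee : e *m e^T = 1%:M.
  rewrite trmx_delta mul_delta_mx; apply/matrixP => i j.
  by rewrite !ord1 !mxE eqxx.
have [->|ve] := eqVneq v e.
  by exists 1%:M; rewrite trmx1 mulmx1 row1.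
pose u : 'rV[R]_n.+1 := v - e; pose N : R := (u *m u^T) 0 0.
  pose c : R := (v *m e^T) 0 0.
have veE : v *m e^T = c%:M by rewrite [LHS]mx11_scalar.
have evE : e *m v^T = c%:M.
  by rewrite -[LHS]trmxK trmx_mul trmxK veE tr_scalar_mx.
have uuE : u *m u^T = (2 - 2 * c)%:M.
  rewrite linearB/= mulmxBr !mulmxBl vv ee veE evE -!raddfB/=.
  by congr _%:M; ring.
have NE : N = 2 - 2 * c by rewrite /N uuE mxE eqxx mulr1n.
have N0 : N != 0.
  have NS : N = \sum_i u 0 i ^+ 2.
    by rewrite /N mxE; apply: eq_bigr => i _; rewrite [u^T _ _]mxE.
  rewrite NS psumr_eq0; last by move=> i _; exact: sqr_ge0.
  apply: contra ve => /allP u0; rewrite -subr_eq0; apply/eqP/rowP => i.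
  by have := u0 i (mem_index_enum _); rewrite sqrf_eq0 !mxE => /eqP.
pose Q : 'M[R]_n.+1 := 1%:M - (2 / N) *: (u^T *m u).
have QT : Q^T = Q by rewrite /Q linearB/= linearZ/= trmx_mul trmxK trmx1.
exists Q; split.
  rewrite QT /Q mulmxBr !mulmxBl !mul1mx mulmx1 -!scalemxAl -!scalemxAr.
  rewrite mulmxA -(mulmxA u^T) uuE -NE mul_mx_scalar -scalemxAl !scalerA.
  have -> : 2 / N * (2 / N * N) = 2 / N + 2 / N by field.
  by rewrite scalerDl; rewrite opprB [X in _ + (X - _)]addrC addrK subrK.
rewrite rowE /Q mulmxBr mulmx1 -scalemxAr mulmxA -/e.
have -> : e *m u^T = (c - 1)%:M.
  by rewrite linearB/= mulmxBr evE ee -raddfB.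
rewrite mul_scalar_mx scalerA.
have -> : 2 / N * (c - 1) = -1.
  by move: N0; rewrite NE => N0; field.
by rewrite scaleN1r opprK addrC subrK.
Qed.

(** Deflation: in an orthonormal basis starting with a unit eigenvector, symmetry makes the matrix
    block diagonal, and induction handles the lower right block. *)
Theorem symmetric_orthodiag (R : realType) d (A : 'M[R]_d) : A^T = A ->
  exists QD, orthodiag A QD.
Proof.
elim: d A => [|n IH] A At.
  exists (1%:M, 0); rewrite /orthodiag/=; split; apply/matrixP; case=> //.
(* The dimension is retyped as [1 + n], so that block matrices apply. *)
move: A At; change (forall A : 'M[R]_(1 + n), A^T = A -> exists QD, orthodiag A QD).
move=> A At.
have [l [v [vA vv]]] : exists (l : R) (v : 'rV[R]_(1 + n)),
  v *m A = l *: v /\ v *m v^T = 1%:M := symmetric_eigenvector At.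
have [Q [QQ Qv]] : exists Q : 'M[R]_(1 + n), Q *m Q^T = 1%:M /\ row 0 Q = v :=
  orthogonal_completion vv.
have QQT := mulmx1C QQ.
pose B : 'M[R]_(1 + n) := Q *m A *m Q^T.
have BT : B^T = B by rewrite /B !trmx_mul trmxK At mulmxA.
have Br : row 0 B = l *: delta_mx 0 0.
  by rewrite /B !row_mul Qv vA -scalemxAl -Qv -row_mul QQ row1.
have AE : A = Q^T *m B *m Q.
  by rewrite /B !mulmxA QQT mul1mx -mulmxA QQT mulmx1.
clearbody B.
have B0 j : B (lshift n 0) j = if j == lshift n 0 then l else 0.
  have /rowP/(_ j) := Br; rewrite !mxE; have -> : lshift n 0 = 0 :> 'I_(1 + n).
    exact/val_inj.
  by move=> ->; case: ifP => _; rewrite ?mulr1 ?mulr0.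
have BE : B = block_mx l%:M 0 0 (drsubmx B).
  rewrite -[LHS]submxK; congr block_mx; apply/matrixP => i j; rewrite !ord1.
  - by rewrite !mxE B0 eqxx.
  - by rewrite !mxE B0 -val_eqE.
  - by rewrite -[in LHS]BT !mxE B0 -val_eqE.
have [|[Q' D'] [/= QQ' BE']] := IH (drsubmx B).
  by rewrite trmx_drsub BT.
pose Q1 : 'M[R]_(1 + n) := block_mx 1%:M 0 0 Q'.
have Q1T : Q1^T = block_mx 1%:M 0 0 Q'^T by rewrite /Q1 tr_block_mx !trmx0 trmx1.
exists (Q1 *m Q, row_mx l%:M D'); split => /=.
  rewrite trmx_mul mulmxA -(mulmxA Q1) QQ mulmx1 Q1T mulmx_block.
  by rewrite !mul1mx !mul0mx !mulmx0 !addr0 !add0r QQ' -scalar_mx_block.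
rewrite AE trmx_mul -!mulmxA; congr (_ *m _); rewrite !mulmxA; congr (_ *m _).
rewrite BE Q1T diag_mx_row /Q1 !mulmx_block.
rewrite !mul1mx !mul0mx !mulmx0 !addr0 !add0r !mulmx1 ?mul0mx.
by rewrite -BE'; congr block_mx; apply/matrixP => i j; rewrite !ord1 !mxE eqxx.
Qed.

(** * Relative entropy *)

Section kl_integral.
Context {R : realType}.
Local Notation mu := (@lebesgue_measure R).
Implicit Types f g : R -> R.

Definition integral01 f : R := (\int[mu]_(s in `[0%R, 1%R]) f s)%R.

Definition continuous01 f := forall s, 0 <= s <= 1 -> {for s, continuous f}.

Lemma eq_continuous01 f g : f =1 g -> continuous01 f -> continuous01 g.
Proof. by move=> /funext ->. Qed.

Lemma continuous01_within f : continuous01 f -> {within `[0, 1], continuous f}.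
Proof.
move=> cf; apply: continuous_in_subspaceT => x /set_mem /=.
by rewrite in_itv/=; exact: cf.
Qed.

Lemma continuous01_integrable f : continuous01 f ->
  mu.-integrable `[0%R, 1%R] (EFin \o f).
Proof.
move=> /continuous01_within cf.
by apply: continuous_compact_integrable => //; exact: segment_compact.
Qed.

Lemma continuous01_sum I (r : seq I) (F : I -> R -> R) :
  (forall i, continuous01 (F i)) -> continuous01 (fun s => \sum_(i <- r) F i s).
Proof.
move=> cF; elim: r => [|i r IH].
  under [X in continuous01 X]eq_fun do rewrite big_nil.
  by move=> s _; exact: cvg_cst.
under [X in continuous01 X]eq_fun do rewrite big_cons.
by move=> s s01; apply: cvgD; [exact: cF|exact: IH].
Qed.

Lemma continuous01M f g : continuous01 f -> continuous01 g ->
  continuous01 (fun s => f s * g s).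
Proof. by move=> cf cg s s01; apply: cvgM; [exact: cf|exact: cg]. Qed.

Lemma continuous01B f g : continuous01 f -> continuous01 g ->
  continuous01 (fun s => f s - g s).
Proof. by move=> cf cg s s01; apply: cvgB; [exact: cf|exact: cg]. Qed.

Lemma continuous01D f g : continuous01 f -> continuous01 g ->
  continuous01 (fun s => f s + g s).
Proof. by move=> cf cg s s01; apply: cvgD; [exact: cf|exact: cg]. Qed.

Lemma continuous01_cst (c : R) : continuous01 (fun=> c).
Proof. by move=> s _; exact: cvg_cst. Qed.

Lemma continuous01_id : continuous01 id.
Proof. by move=> s _; exact: cvg_id. Qed.

Lemma continuous01V f : (forall s, 0 <= s <= 1 -> f s != 0) -> continuous01 f ->
  continuous01 (fun s => (f s)^-1).
Proof. by move=> f0 cf s s01; apply: cvgV; [exact: f0|exact: cf]. Qed.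

Lemma integral01D f g : continuous01 f -> continuous01 g ->
  integral01 (fun s => f s + g s) = integral01 f + integral01 g.
Proof.
move=> cf cg; rewrite /integral01 RintegralD//; exact: continuous01_integrable.
Qed.

Lemma integral01Zl (k : R) f : continuous01 f ->
  integral01 (fun s => k * f s) = k * integral01 f.
Proof.
move=> cf; rewrite /integral01 RintegralZl//; exact: continuous01_integrable.
Qed.

Lemma integral01_sum I (r : seq I) (F : I -> R -> R) :
  (forall i, continuous01 (F i)) ->
  integral01 (fun s => \sum_(i <- r) F i s) = \sum_(i <- r) integral01 (F i).
Proof.
move=> cF; elim: r => [|i r IH].
  rewrite big_nil; under [X in integral01 X]eq_fun do rewrite big_nil.
  by rewrite /integral01 Rintegral_cst// mul0r.
under [X in integral01 X]eq_fun do rewrite big_cons.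
by rewrite big_cons integral01D ?IH//; exact: continuous01_sum.
Qed.

Lemma integral01_le f g : continuous01 f -> continuous01 g ->
  (forall s, 0 <= s <= 1 -> f s <= g s) -> integral01 f <= integral01 g.
Proof.
move=> cf cg fg; by apply: le_Rintegral => //; exact: continuous01_integrable.
Qed.

Lemma integral01_eq f g : (forall s, 0 <= s <= 1 -> f s = g s) ->
  integral01 f = integral01 g.
Proof.
move=> fg; apply: eq_Rintegral => s /set_mem /=; rewrite in_itv/=; exact: fg.
Qed.

Lemma convex_comb_gt0 (a x s : R) : 0 < a -> 0 < x -> 0 <= s <= 1 ->
  0 < (1 - s) * a + s * x.
Proof.
move=> a0 x0 /andP[s0 s1]; have [->|s1'] := eqVneq s 1.
  by rewrite subrr mul0r add0r mul1r.
rewrite ltr_pwDl// ?mulr_ge0 ?(ltW x0)// mulr_gt0// subr_gt0.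
by rewrite lt_neqAle s1' s1.
Qed.

(** The Bregman divergence of [x ln x], that is, the scalar relative entropy for unnormalised
    masses. *)
Definition kl (x a : R) := x * ln x - x * ln a - x + a.

(** The integrand of the Taylor remainder of [x ln x] at [a]: the second derivative at
    [(1 - s) a + s x] is the inverse of that point. *)
Definition kl_kernel (x a s : R) :=
  (1 - s) * ((x - a) ^+ 2 / ((1 - s) * a + s * x)).

Lemma continuous01_comb (a x : R) :
  continuous01 (fun s => (1 - s) * a + s * x).
Proof.
apply: continuous01D; apply: continuous01M.
- by apply: continuous01B; [exact: continuous01_cst|exact: continuous01_id].
- exact: continuous01_cst.
- exact: continuous01_id.
- exact: continuous01_cst.
Qed.

Lemma continuous01_kl_kernel (x a : R) : 0 < x -> 0 < a ->
  continuous01 (kl_kernel x a).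
Proof.
move=> x0 a0; apply: continuous01M.
  by apply: continuous01B; [exact: continuous01_cst|exact: continuous01_id].
apply: continuous01M; first exact: continuous01_cst.
apply: continuous01V; last exact: continuous01_comb.
by move=> s s01; rewrite lt0r_neq0// convex_comb_gt0.
Qed.

Lemma kl_integral (x a : R) : 0 < x -> 0 < a ->
  kl x a = integral01 (kl_kernel x a).
Proof.
move=> x0 a0; pose y (s : R) : R := (1 - s) * a + s * x.
(* As [(1 - s) * (x - a) = x - y s], the integrand is [x * y' / y - y']. *)
pose F (s : R) : R := x * ln (y s) - y s.
have yd (s : R) : is_derive s (1:R) y (x - a).
  by rewrite /y; apply: is_derive_eq; rewrite /GRing.scale/=; ring.
have Fd (s : R) : 0 <= s <= 1 -> is_derive s (1:R) F (kl_kernel x a s).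
  move=> s01; have y0 := convex_comb_gt0 a0 x0 s01.
  have lnd : is_derive (y s) (1:R) (@ln R) (y s)^-1 by exact: is_derive1_ln.
  have lnyd := is_derive1_comp lnd (yd s).
  apply: is_derive_eq.
  rewrite /GRing.scale/= /kl_kernel -/(y s).
  have : y s != 0 by rewrite lt0r_neq0.
  by rewrite /y => ?; field.
have Fc (s : R) : 0 <= s <= 1 -> {for s, continuous F}.
  by move=> /Fd Fds; apply/differentiable_continuous/derivable1_diffP.
rewrite /integral01 /Rintegral (@continuous_FTC2 _ _ F).
- rewrite /F /y /kl/= !subrr !mul0r !mul1r !subr0 !add0r !addr0 !mul1r.
  by ring.
- exact: ltr01.
- exact/continuous01_within/continuous01_kl_kernel.
- split => [s|/=|/=].
  + by rewrite in_itv/= => /andP[s0 s1]; have [] := Fd s; rewrite ?ltW.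
  + by apply: cvg_at_right_filter; apply: Fc; rewrite lexx ler01.
  + by apply: cvg_at_left_filter; apply: Fc; rewrite lexx ler01.
- move=> s; rewrite in_itv/= => /andP[s0 s1]; rewrite derive1E.
  by have := Fd s; rewrite !ltW// => /(_ isT) [].
Qed.

(** Follows from [ln t <= t - 1] at [t = x / a]. The right-hand side is [(x - a)^2 / a], of second
    order in [x - a]. *)
Lemma kl_le_chi2 (x a : R) : 0 < x -> 0 < a -> kl x a <= x ^+ 2 / a - x *+ 2 + a.
Proof.
move=> x0 a0; have : ln (x / a) <= x / a - 1.
  have -> : ln (x / a) = ln (1 + (x / a - 1)) by rewrite addrC subrK.
  by apply: le_ln1Dx; rewrite ltrBrDl subrr divr_gt0.
rewrite ln_div// => /(ler_wpM2l (ltW x0)) h; rewrite /kl.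
have : x * (x / a - 1) = x ^+ 2 / a - x by field; rewrite lt0r_neq0.
by lra.
Qed.

End kl_integral.

(** * Functional calculus, and traces in two eigenbases *)

Section spectral_calculus.
Context {R : realType} {d : nat}.
Implicit Types (A X B H K V W Q P : 'M[R]_d) (D E : 'rV[R]_d) (f g : R -> R).

Lemma symD A B : A^T = A -> B^T = B -> (A + B)^T = A + B.
Proof. by move=> At Bt; rewrite linearD/= At Bt. Qed.

Lemma symB A B : A^T = A -> B^T = B -> (A - B)^T = A - B.
Proof. by move=> At Bt; rewrite linearB/= At Bt. Qed.

Lemma symZ (c : R) A : A^T = A -> (c *: A)^T = c *: A.
Proof. by move=> At; rewrite linearZ/= At. Qed.

(** Positivity is put on the eigenvalues, the form in which the entropy sums use it; [pdmx_quad]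
    recovers it from the quadratic form. *)
Definition pdmx A := exists QD, orthodiag A QD /\ forall i, 0 < QD.2 0 i.

Lemma orthodiag_trmx A QD : orthodiag A QD -> A^T = A.
Proof. by case=> _ ->; rewrite !trmx_mul trmxK tr_diag_mx mulmxA. Qed.

Lemma pdmx_trmx A : pdmx A -> A^T = A.
Proof. by case=> QD [/orthodiag_trmx]. Qed.

Lemma orthodiag_mxfun f A Q D : orthodiag A (Q, D) ->
  orthodiag (mxfun f A) (Q, map_mx f D).
Proof. by move=> AQD; split; [case: AQD|rewrite (mxfunE _ AQD)]. Qed.

Lemma mxfun_trmx f A : A^T = A -> (mxfun f A)^T = mxfun f A.
Proof. by move=> /symmetric_orthodiag[[Q D]] /(orthodiag_mxfun f)/orthodiag_trmx. Qed.

Lemma orthodiag_eq_mxfun f g A Q D : orthodiag A (Q, D) ->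
  (forall i, f (D 0 i) = g (D 0 i)) -> mxfun f A = mxfun g A.
Proof.
move=> AQD fg; rewrite !(mxfunE _ AQD); congr (_ *m diag_mx _ *m _).
by apply/rowP => i; rewrite !mxE.
Qed.

Lemma mxfun_comp f g A : A^T = A -> mxfun f (mxfun g A) = mxfun (f \o g) A.
Proof.
move=> /symmetric_orthodiag[[Q D] AQD].
by rewrite (mxfunE _ (orthodiag_mxfun g AQD)) (mxfunE _ AQD) map_mx_comp.
Qed.

Lemma mxfun_id A : A^T = A -> mxfun id A = A.
Proof.
move=> /symmetric_orthodiag[[Q D] AQD]; rewrite (mxfunE _ AQD) map_mx_id//.
by case: AQD.
Qed.

(** Any orthonormal basis diagonalizes the identity, so an absent factor of a trace can be filled in
    by a constant diagonal. *)
Lemma orthogonal_conj1 Q : Q *m Q^T = 1%:M -> 1%:M = Q^T *m diag_mx (const_mx 1) *m Q.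
Proof. by move=> /mulmx1C QQ; rewrite diag_const_mx mulmx1 QQ. Qed.

Lemma mxfun_cst1 A : A^T = A -> mxfun (fun=> 1) A = 1%:M.
Proof.
move=> /symmetric_orthodiag[[Q D] AQD]; rewrite (mxfunE _ AQD).
have -> : map_mx (fun=> 1) D = const_mx 1 :> 'rV[R]_d.
  by apply/rowP => i; rewrite !mxE.
by rewrite -orthogonal_conj1//; case: AQD.
Qed.

Lemma mxfunM f g A : A^T = A ->
  mxfun f A *m mxfun g A = mxfun (fun x => f x * g x) A.
Proof.
move=> /symmetric_orthodiag[[Q D] AQD]; rewrite !(mxfunE _ AQD).
have [/= QQ _] := AQD.
rewrite !mulmxA -(mulmxA _ Q) QQ mulmx1 -(mulmxA Q^T) mulmx_diag.
by congr (_ *m diag_mx _ *m _); apply/rowP => i; rewrite !mxE.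
Qed.

Lemma expmx_trmx A : A^T = A -> (expmx A)^T = expmx A.
Proof. exact: mxfun_trmx. Qed.

Lemma logmx_trmx A : A^T = A -> (logmx A)^T = logmx A.
Proof. exact: mxfun_trmx. Qed.

Lemma expmx_pd A : A^T = A -> pdmx (expmx A).
Proof.
move=> /symmetric_orthodiag[[Q D] /(orthodiag_mxfun expR) AQD].
by exists (Q, map_mx expR D); split => // i; rewrite mxE expR_gt0.
Qed.

Lemma expmxK A : A^T = A -> logmx (expmx A) = A.
Proof.
move=> At; rewrite /logmx /expmx mxfun_comp// -[RHS]mxfun_id//; congr mxfun.
by apply/funext => x /=; rewrite expRK.
Qed.

Lemma tr_mulE (n m : nat) (M : 'M[R]_(n, m)) (N : 'M[R]_(m, n)) :
  \tr (M *m N) = \sum_i \sum_j M i j * N j i.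
Proof. by rewrite /mxtrace; apply: eq_bigr => i _; rewrite mxE. Qed.

(** The traces of the entropy argument are instances, with [V] and [W] the identity or the
    variational matrix; all become sums over the same pairs of eigenvectors. *)
Lemma mxtrace_sandwich Q P D E V W :
  \tr (V^T *m (Q^T *m diag_mx D *m Q) *m W *m (P^T *m diag_mx E *m P)) =
  \sum_i \sum_j (Q *m V *m P^T) i j * (Q *m W *m P^T) i j * (D 0 i * E 0 j).
Proof.
rewrite !mulmxA mxtrace_mulC !mulmxA.
pose V' := Q *m V *m P^T; pose W' := Q *m W *m P^T.
have -> : P *m V^T *m Q^T = V'^T by rewrite !trmx_mul trmxK mulmxA.
have -> : V'^T *m diag_mx D *m Q *m W *m P^T *m diag_mx E =
          V'^T *m (diag_mx D *m (W' *m diag_mx E)) by rewrite /W' !mulmxA.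
rewrite exchange_big tr_mulE; apply: eq_bigr => j _.
apply: eq_bigr => i _; rewrite -/V' -/W' mul_diag_mx mul_mx_diag !mxE -/V' -/W'.
by ring.
Qed.

End spectral_calculus.

(** * Tangent functionals of the matrix relative entropy *)

Section relative_entropy.
Context {R : realType} {d : nat}.
Implicit Types (A X B H K V W Q P : 'M[R]_d) (D E : 'rV[R]_d) (f g : R -> R).

Lemma mxtrace_mxfunM f g A X Q P D E :
  orthodiag A (Q, D) -> orthodiag X (P, E) ->
  \tr (mxfun f A *m mxfun g X) =
  \sum_i \sum_j (Q *m P^T) i j ^+ 2 * (f (D 0 i) * g (E 0 j)).
Proof.
move=> AQD XPE; rewrite (mxfunE _ AQD) (mxfunE _ XPE).
have := mxtrace_sandwich Q P (map_mx f D) (map_mx g E) 1%:M 1%:M.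
rewrite trmx1 mul1mx mulmx1 => ->; apply: eq_bigr => i _; apply: eq_bigr => j _.
by rewrite mulmx1 !mxE expr2.
Qed.

Definition relent X A :=
  \tr (X *m logmx X) - \tr (X *m logmx A) - \tr X + \tr A.

Lemma relentE A X Q P D E : orthodiag A (Q, D) -> orthodiag X (P, E) ->
  relent X A = \sum_i \sum_j (Q *m P^T) i j ^+ 2 * kl (E 0 j) (D 0 i).
Proof.
move=> AQD XPE; have At := orthodiag_trmx AQD; have Xt := orthodiag_trmx XPE.
(* The constant function 1 supplies the absent factor, so that all four traces have the form
   [\tr (f(A) g(X))] and share the same weights. *)
have tr1 : \tr (X *m logmx X) = \tr (mxfun (fun=> 1) A *m mxfun (fun x => x * ln x) X).
  by rewrite mxfun_cst1// mul1mx -mxfunM// mxfun_id.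
have tr2 : \tr (X *m logmx A) = \tr (mxfun (@ln R) A *m mxfun id X).
  by rewrite mxtrace_mulC mxfun_id.
have tr3 : \tr X = \tr (mxfun (fun=> 1) A *m mxfun id X).
  by rewrite mxfun_cst1// mul1mx mxfun_id.
have tr4 : \tr A = \tr (mxfun id A *m mxfun (fun=> 1) X).
  by rewrite mxfun_cst1// mulmx1 mxfun_id.
rewrite /relent tr1 tr2 {}tr3 {}tr4 !(mxtrace_mxfunM _ _ AQD XPE).
rewrite -!sumrB -big_split/=; apply: eq_bigr => i _.
rewrite -!sumrB -big_split/=; apply: eq_bigr => j _.
by rewrite /kl; ring.
Qed.

(* Completing the square entrywise: for each [s] the kernel sum dominates an
   affine function of [(X, A)], with equality for an explicit [W]. *)
Lemma kl_kernel_sum_ge A X W Q P D E (s : R) :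
  orthodiag A (Q, D) -> orthodiag X (P, E) ->
  (forall i, 0 < D 0 i) -> (forall j, 0 < E 0 j) -> 0 <= s <= 1 ->
  let m i j := (1 - s) * D 0 i + s * E 0 j in
  let C := Q *m P^T in
  let tangent := \tr (((1 - s) *: (2 *: W^T - s *: (W^T *m W))) *m X) +
                 \tr (((s - 1) *: (2 *: W^T + (1 - s) *: (W *m W^T))) *m A) in
  tangent <= \sum_i \sum_j C i j ^+ 2 * kl_kernel (E 0 j) (D 0 i) s /\
  ((forall i j, (Q *m W *m P^T) i j = C i j * (E 0 j - D 0 i) / m i j) ->
   tangent = \sum_i \sum_j C i j ^+ 2 * kl_kernel (E 0 j) (D 0 i) s).
Proof.
move=> [QQ AE] [PP XE] D0 E0 s01 m C tangent.
simpl in QQ, AE, PP, XE.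
pose W' := Q *m W *m P^T.
have trX : \tr (W^T *m X) = \sum_i \sum_j W' i j * C i j * E 0 j.
  have := mxtrace_sandwich Q P (const_mx 1) E W 1%:M.
  rewrite -orthogonal_conj1// !mulmx1 -XE => ->.
  by do 2 (apply: eq_bigr => ? _); rewrite [const_mx _ _ _]mxE mul1r.
have trA : \tr (W^T *m A) = \sum_i \sum_j W' i j * C i j * D 0 i.
  have := mxtrace_sandwich Q P D (const_mx 1) W 1%:M.
  rewrite -orthogonal_conj1// !mulmx1 -AE => ->.
  by do 2 (apply: eq_bigr => ? _); rewrite [const_mx _ _ _]mxE mulr1.
have trWX : \tr (W^T *m W *m X) = \sum_i \sum_j W' i j ^+ 2 * E 0 j.
  have := mxtrace_sandwich Q P (const_mx 1) E W W.
  rewrite -orthogonal_conj1// !mulmx1 -XE => ->.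
  by do 2 (apply: eq_bigr => ? _); rewrite [const_mx _ _ _]mxE mul1r -expr2.
have trWA : \tr (W *m W^T *m A) = \sum_i \sum_j W' i j ^+ 2 * D 0 i.
  rewrite -mulmxA mxtrace_mulC.
  have := mxtrace_sandwich Q P D (const_mx 1) W W.
  rewrite -orthogonal_conj1// !mulmx1 -AE => ->.
  by do 2 (apply: eq_bigr => ? _); rewrite [const_mx _ _ _]mxE mulr1 -expr2.
(* Entry by entry the tangent is a concave quadratic in [W' i j], with maximum at
   [C i j * (E 0 j - D 0 i) / m i j]. *)
have tangentE : tangent = \sum_i \sum_j (1 - s) *
    (2 * W' i j * C i j * (E 0 j - D 0 i) - m i j * W' i j ^+ 2).
  rewrite /tangent -!scalemxAl !mxtraceZ mulmxBl mulmxDl !raddfB/= !raddfD/=.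
  rewrite -!scalemxAl !mxtraceZ trX trA trWX trWA.
  rewrite !mulr_sumr -!sumrB -!big_split/= !mulr_sumr -big_split/=.
  apply: eq_bigr => i _.
  rewrite !mulr_sumr -!sumrB -!big_split/= !mulr_sumr -big_split/=.
  by apply: eq_bigr => j _; rewrite /m; ring.
have m0 i j : 0 < m i j by exact: convex_comb_gt0.
split.
  rewrite tangentE; apply: ler_sum => i _; apply: ler_sum => j _.
  rewrite /kl_kernel -/(m i j) [leRHS]mulrCA; apply: ler_wpM2l.
    by rewrite subr_ge0; case/andP: s01.
  rewrite -subr_ge0.
  have -> : C i j ^+ 2 * ((E 0 j - D 0 i) ^+ 2 / m i j) -
     (2 * W' i j * C i j * (E 0 j - D 0 i) - m i j * W' i j ^+ 2) =
     (C i j * (E 0 j - D 0 i) - m i j * W' i j) ^+ 2 / m i j.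
    by field; rewrite lt0r_neq0.
  by rewrite divr_ge0 ?sqr_ge0// ltW.
move=> WE; rewrite tangentE; apply: eq_bigr => i _; apply: eq_bigr => j _.
rewrite /kl_kernel -/(m i j) [W' i j]WE.
by field; rewrite lt0r_neq0.
Qed.

(** Integrating the slope matrices entrywise turns a family of linear functionals into a single
    one. *)
Lemma mxtrace_integral01 (p : R -> 'M[R]_d) X :
  (forall i j, continuous01 (fun s => p s i j)) ->
  \tr ((\matrix_(i, j) integral01 (fun s => p s i j)) *m X) =
  integral01 (fun s => \tr (p s *m X)).
Proof.
move=> cp; rewrite tr_mulE.
under [in RHS]eq_fun do rewrite tr_mulE.
have cpX i j : continuous01 (fun s => p s i j * X j i).
  by apply: continuous01M => //; exact: continuous01_cst.
rewrite integral01_sum; last by move=> i; exact: continuous01_sum.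
apply: eq_bigr => i _; rewrite integral01_sum//; apply: eq_bigr => j _.
rewrite mxE; under [in RHS]eq_fun do rewrite mulrC.
by rewrite integral01Zl// mulrC.
Qed.

Lemma continuous01_mxtrace (p : R -> 'M[R]_d) X :
  (forall i j, continuous01 (fun s => p s i j)) ->
  continuous01 (fun s => \tr (p s *m X)).
Proof.
move=> cp; under [X in continuous01 X]eq_fun do rewrite tr_mulE.
apply: continuous01_sum => i; apply: continuous01_sum => j.
by apply: continuous01M => //; exact: continuous01_cst.
Qed.

Theorem relent_tangent X0 A0 : pdmx X0 -> pdmx A0 -> exists P Q,
  (forall X A, pdmx X -> pdmx A -> \tr (P *m X) + \tr (Q *m A) <= relent X A) /\
  relent X0 A0 = \tr (P *m X0) + \tr (Q *m A0).
Proof.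
move=> [[P0 E0] [X0PE /= E0_gt0]] [[Q0 D0] [A0QD /= D0_gt0]].
have [/= QQ _] := A0QD; have [/= PP _] := X0PE.
pose C := Q0 *m P0^T.
(* The optimal entries from [kl_kernel_sum_ge] at [(X0, A0)]; [W s] carries them back from the two
   eigenbases. *)
pose w (s : R) i j := C i j * (E0 0 j - D0 0 i) / ((1 - s) * D0 0 i + s * E0 0 j).
pose W s := Q0^T *m (\matrix_(i, j) w s i j) *m P0.
have cw i j : continuous01 (fun s => w s i j).
  apply: continuous01M; first exact: continuous01_cst.
  apply: continuous01V; last exact: continuous01_comb.
  by move=> s s01; rewrite lt0r_neq0// convex_comb_gt0.
have cW i j : continuous01 (fun s => W s i j).
  apply: (@eq_continuous01 _
    (fun s => \sum_k (\sum_l Q0^T i l * w s l k) * P0 k j)).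
    move=> s; rewrite [RHS]mxE; apply: eq_bigr => k _; congr (_ * _).
    by rewrite [RHS]mxE; apply: eq_bigr => l _; rewrite [in RHS]mxE.
  apply: continuous01_sum => k; apply: continuous01M; last exact: continuous01_cst.
  apply: continuous01_sum => l; apply: continuous01M; last exact: cw.
  exact: continuous01_cst.
pose p s := (1 - s) *: (2 *: (W s)^T - s *: ((W s)^T *m W s)).
pose q s := (s - 1) *: (2 *: (W s)^T + (1 - s) *: (W s *m (W s)^T)).
have cp i j : continuous01 (fun s => p s i j).
  apply: (@eq_continuous01 _ (fun s =>
    (1 - s) * (2 * W s j i - s * \sum_k W s k i * W s k j))).
    move=> s; rewrite !mxE; congr (_ * (_ - _ * _)).
    by apply: eq_bigr => k _; rewrite [(W s)^T _ _]mxE.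
  apply: continuous01M.
    by apply: continuous01B; [exact: continuous01_cst|exact: continuous01_id].
  apply: continuous01B; apply: continuous01M.
  - exact: continuous01_cst.
  - exact: cW.
  - exact: continuous01_id.
  - by apply: continuous01_sum => k; apply: continuous01M.
have cq i j : continuous01 (fun s => q s i j).
  apply: (@eq_continuous01 _ (fun s =>
    (s - 1) * (2 * W s j i + (1 - s) * \sum_k W s i k * W s j k))).
    move=> s; rewrite !mxE; congr (_ * (_ + _ * _)).
    by apply: eq_bigr => k _; rewrite [(W s)^T _ _]mxE.
  apply: continuous01M.
    by apply: continuous01B; [exact: continuous01_id|exact: continuous01_cst].
  apply: continuous01D; apply: continuous01M.
  - exact: continuous01_cst.
  - exact: cW.
  - by apply: continuous01B; [exact: continuous01_cst|exact: continuous01_id].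
  - by apply: continuous01_sum => k; apply: continuous01M.
have ctan X A : continuous01 (fun s => \tr (p s *m X) + \tr (q s *m A)).
  by apply: continuous01D; exact: continuous01_mxtrace.
have relent_int X A Q P D E : orthodiag A (Q, D) -> orthodiag X (P, E) ->
  (forall i, 0 < D 0 i) -> (forall j, 0 < E 0 j) ->
  relent X A = integral01 (fun s =>
     \sum_i \sum_j (Q *m P^T) i j ^+ 2 * kl_kernel (E 0 j) (D 0 i) s) /\
  continuous01 (fun s =>
     \sum_i \sum_j (Q *m P^T) i j ^+ 2 * kl_kernel (E 0 j) (D 0 i) s).
  move=> AQD XPE D_gt0 E_gt0.
  have ck i j :
      continuous01 (fun s => (Q *m P^T) i j ^+ 2 * kl_kernel (E 0 j) (D 0 i) s).
    by apply: continuous01M; [exact: continuous01_cst|exact: continuous01_kl_kernel].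
  split; last by do 2 apply: continuous01_sum => ?.
  rewrite (relentE AQD XPE) integral01_sum; last first.
    by move=> i; exact: continuous01_sum.
  apply: eq_bigr => i _; rewrite integral01_sum//; apply: eq_bigr => j _.
  by rewrite integral01Zl ?kl_integral//; exact: continuous01_kl_kernel.
exists (\matrix_(i, j) integral01 (fun s => p s i j)).
exists (\matrix_(i, j) integral01 (fun s => q s i j)); split.
  move=> X A [[P E] [XPE /= E_gt0]] [[Q D] [AQD /= D_gt0]].
  rewrite !mxtrace_integral01// -integral01D; try exact: continuous01_mxtrace.
  have [-> cR] := relent_int _ _ _ _ _ _ AQD XPE D_gt0 E_gt0.
  apply: integral01_le => // s s01.
  (* The inequality holds for any matrix, so [W s], built from [(X0, A0)], may be used in the
     eigenbases of the arbitrary pair [(X, A)]. *)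
  exact: (kl_kernel_sum_ge _ AQD XPE D_gt0 E_gt0 s01).1.
rewrite !mxtrace_integral01// -integral01D; try exact: continuous01_mxtrace.
have [-> _] := relent_int _ _ _ _ _ _ A0QD X0PE D0_gt0 E0_gt0.
apply: integral01_eq => s s01; apply/esym.
apply: (kl_kernel_sum_ge _ A0QD X0PE D0_gt0 E0_gt0 s01).2 => i j.
by rewrite /W !mulmxA QQ mul1mx -mulmxA PP mulmx1 mxE.
Qed.

End relative_entropy.

(** * Lieb's concavity theorem *)

Section lieb.
Context {R : realType} {d : nat}.
Implicit Types (A X B H K V W Q P : 'M[R]_d) (D E : 'rV[R]_d) (f g : R -> R).

Lemma quad_orthodiag A Q D (u : 'rV[R]_d) : orthodiag A (Q, D) ->
  (u *m A *m u^T) 0 0 = \sum_i (u *m Q^T) 0 i ^+ 2 * D 0 i.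
Proof.
move=> [/= _ ->]; rewrite !mulmxA -(mulmxA _ Q).
have -> : Q *m u^T = (u *m Q^T)^T by rewrite trmx_mul trmxK.
rewrite mul_mx_diag mxE; apply: eq_bigr => i _.
by rewrite !mxE; ring.
Qed.

Lemma sum_sqr_orthogonal Q (u : 'rV[R]_d) : Q *m Q^T = 1%:M -> u *m u^T = 1%:M ->
  \sum_i (u *m Q^T) 0 i ^+ 2 = 1.
Proof.
move=> QQ uu.
have := @quad_orthodiag 1%:M Q (const_mx 1) u (conj QQ (orthogonal_conj1 QQ)).
rewrite mulmx1 uu mxE eqxx mulr1n => ->.
by apply: eq_bigr => i _; rewrite [const_mx _ _ _]mxE mulr1.
Qed.

Lemma row_unit Q i : Q *m Q^T = 1%:M -> row i Q *m (row i Q)^T = 1%:M.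
Proof.
move=> QQ; rewrite tr_row rowE colE -mulmxA (mulmxA Q) QQ mul1mx.
by rewrite mul_delta_mx; apply/matrixP => k l; rewrite !ord1 !mxE !eqxx.
Qed.

Lemma orthodiag_row A Q D i : orthodiag A (Q, D) ->
  (row i Q *m A *m (row i Q)^T) 0 0 = D 0 i.
Proof.
move=> AQD; rewrite (quad_orthodiag _ AQD) (bigD1 i)//= big1 ?addr0.
  by case: AQD => /= QQ _; rewrite -row_mul QQ row1 mxE !eqxx expr1n mul1r.
move=> j ji; case: AQD => /= QQ _.
by rewrite -row_mul QQ row1 mxE eqxx (negbTE ji)/= expr0n mul0r.
Qed.

Lemma pdmx_quad A : A^T = A ->
  (forall u : 'rV_d, u *m u^T = 1%:M -> 0 < (u *m A *m u^T) 0 0) -> pdmx A.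
Proof.
move=> /symmetric_orthodiag[[Q D] AQD] A0; exists (Q, D); split => //= i.
by rewrite -(orthodiag_row i AQD) A0// row_unit//; case: AQD.
Qed.

Lemma pdmx_quad_ge A : pdmx A -> exists2 m, 0 < m &
  forall u : 'rV_d, u *m u^T = 1%:M -> m <= (u *m A *m u^T) 0 0.
Proof.
move=> [[Q D] [AQD /= D0]]; have [/= QQ _] := AQD.
have S0 : 0 < 1 + \sum_i (D 0 i)^-1.
  by rewrite ltr_pwDl// sumr_ge0// => i _; rewrite invr_ge0 ltW.
(* A positive lower bound of all eigenvalues, since its inverse exceeds each [(D 0 i)^-1]; the term
   1 keeps it positive in dimension 0. *)
exists (1 + \sum_i (D 0 i)^-1)^-1; first by rewrite invr_gt0.
move=> u uu; rewrite (quad_orthodiag _ AQD) -[leLHS]mul1r.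
rewrite -[X in X * _ <= _](sum_sqr_orthogonal QQ uu) mulr_suml; apply: ler_sum => i _.
rewrite ler_wpM2l ?sqr_ge0//.
rewrite -[leRHS]invrK lef_pV2 ?posrE ?invr_gt0//.
rewrite (bigD1 i)//= addrCA lerDl addr_ge0// sumr_ge0// => j _.
by rewrite invr_ge0 ltW.
Qed.

Lemma pdmx_quad_le A : pdmx A -> exists2 m, 0 < m &
  forall u : 'rV_d, u *m u^T = 1%:M -> (u *m A *m u^T) 0 0 <= m.
Proof.
move=> [[Q D] [AQD /= D0]]; have [/= QQ _] := AQD.
exists (1 + \sum_i D 0 i).
  by rewrite ltr_pwDl// sumr_ge0// => i _; rewrite ltW.
move=> u uu; rewrite (quad_orthodiag _ AQD) -[leRHS]mul1r.
rewrite -[X in _ <= X * _](sum_sqr_orthogonal QQ uu) mulr_suml; apply: ler_sum => i _.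
rewrite ler_wpM2l ?sqr_ge0//.
rewrite (bigD1 i)//= addrCA lerDl addr_ge0// sumr_ge0// => j _.
by rewrite ltW.
Qed.

Lemma pdmx_scale (c : R) A : 0 < c -> pdmx A -> pdmx (c *: A).
Proof.
move=> c0 pA; apply: pdmx_quad; first by rewrite linearZ/= pdmx_trmx.
have [m m0 mA] := pdmx_quad_ge pA.
move=> u uu; rewrite -scalemxAr -scalemxAl mxE mulr_gt0//.
exact: lt_le_trans (mA u uu).
Qed.

(** The threshold is a lower bound of the form of [A] over an upper bound of that of [X]. The
    perturbation is spelled as a direction, to fit [relent_slope]. *)
Lemma pdmx_sub_small A X : pdmx A -> pdmx X -> exists2 e0, 0 < e0 &
  forall e, 0 < e < e0 -> pdmx (A + e *: - X).
Proof.
move=> pA pX; have [m m0 mA] := pdmx_quad_ge pA.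
have [M M0 MX] := pdmx_quad_le pX.
exists (m / M); first exact: divr_gt0.
move=> e /andP[e0 em]; apply: pdmx_quad.
  by rewrite linearD linearZ linearN/= !pdmx_trmx.
move=> u uu; rewrite mulmxDr mulmxDl mxE scalerN mulmxN mulNmx [X in _ + X]mxE.
rewrite -scalemxAr -scalemxAl [X in _ - X]mxE subr_gt0.
apply: lt_le_trans (mA u uu); apply: (@le_lt_trans _ _ (e * M)).
  by apply: ler_wpM2l; [exact: ltW|exact: MX].
by rewrite -ltr_pdivlMr.
Qed.

Lemma psdmx_scale (c : R) A : 0 < c -> psdmx A -> psdmx (c *: A).
Proof.
move=> c0 [/symmetricmxP At A0]; split; first by apply/symmetricmxP/symZ.
by move=> x; rewrite -scalemxAr -scalemxAl mxE mulr_ge0// ltW.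
Qed.

Lemma le_of_le_small (a b c e0 : R) : 0 < e0 ->
  (forall e, 0 < e < e0 -> a <= b + e * c) -> a <= b.
Proof.
move=> e00 h; rewrite leNgt; apply/negP => ba.
(* Small enough to be admissible and to keep [e * c] at most half the gap [a - b]; the [+ 1] covers
   [c = 0]. *)
pose e := Num.min (e0 / 2) ((a - b) / (2 * (`|c| + 1))).
have c1 : 0 < `|c| + 1 by rewrite ltr_wpDl.
have e_gt0 : 0 < e.
  by rewrite lt_min !divr_gt0// ?subr_gt0// mulr_gt0.
have e_lt : e < e0 by rewrite gt_min ltr_pdivrMr// ltr_pMr// ltr1n.
have := h e; rewrite e_gt0 e_lt => /(_ isT).
have : e * c <= (a - b) / 2.
  have : e <= (a - b) / (2 * (`|c| + 1)) by rewrite ge_min lexx orbT.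
  rewrite ler_pdivlMr; last by rewrite mulr_gt0.
  have := ler_norm c; have := ltW e_gt0; nra.
by lra.
Qed.

Lemma mxfun_invK A : pdmx A -> mxfun (fun x => x^-1) A *m A = 1%:M.
Proof.
move=> [[Q D] [AQD /= D0]]; have At := orthodiag_trmx AQD.
have [/= QQ AE] := AQD; rewrite -[X in _ *m X]mxfun_id// mxfunM// (mxfunE _ AQD).
rewrite [RHS](orthogonal_conj1 QQ); congr (_ *m diag_mx _ *m _).
by apply/rowP => i; rewrite !mxE/= mulVf// lt0r_neq0.
Qed.

(** This is [kl_le_chi2] summed over pairs of eigenvectors. The bound equals [\tr (A^-1 (X - A)^2)],
    hence is quadratic in the displacement. *)
Lemma relent_le X A : pdmx X -> pdmx A ->
  relent X A <= \tr (mxfun (fun x => x^-1) A *m (X *m X)) - \tr X *+ 2 + \tr A.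
Proof.
move=> [[P E] [XPE /= E0]] [[Q D] [AQD /= D0]].
have At := orthodiag_trmx AQD; have Xt := orthodiag_trmx XPE.
have [/= PP _] := XPE; have [/= QQ _] := AQD.
have XX : X *m X = mxfun (fun x => x * x) X by rewrite -mxfunM// mxfun_id.
have tr3 : \tr X = \tr (mxfun (fun=> 1) A *m mxfun id X).
  by rewrite mxfun_cst1// mul1mx mxfun_id.
have tr4 : \tr A = \tr (mxfun id A *m mxfun (fun=> 1) X).
  by rewrite mxfun_cst1// mulmx1 mxfun_id.
rewrite (relentE AQD XPE) XX {}tr3 {}tr4 !(mxtrace_mxfunM _ _ AQD XPE).
rewrite -sumrMnl -sumrB -big_split/=; apply: ler_sum => i _.
rewrite -sumrMnl -sumrB -big_split/=; apply: ler_sum => j _.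
have /(ler_wpM2l (sqr_ge0 ((Q *m P^T) i j))) := kl_le_chi2 (E0 j) (D0 i).
by move=> /le_trans; apply; rewrite le_eqVlt; apply/orP; left; apply/eqP; ring.
Qed.

(** The three-point identity of a Bregman divergence: it exhibits [logmx A - logmx B] as the
    gradient of the entropy relative to [B] at [A], with remainder [relent X A]. *)
Lemma relent_pythagoras X A B : relent X B =
  relent A B + \tr ((logmx A - logmx B) *m (X - A)) + relent X A.
Proof.
rewrite /relent mulmxBl !mulmxBr !raddfB/=.
rewrite (mxtrace_mulC (logmx A) X) (mxtrace_mulC (logmx A) A).
rewrite (mxtrace_mulC (logmx B) X) (mxtrace_mulC (logmx B) A).
by ring.
Qed.

(* The slope [P] of the tangent functional at [(A, B)] in the direction of the
   first argument agrees with the gradient [logmx A - logmx B], because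
   [relent X A] is quadratically small in [X - A]. *)
Lemma relent_slope P (c : R) A B K (e0 : R) : pdmx A ->
  (forall X, pdmx X -> \tr (P *m X) + c <= relent X B) ->
  relent A B = \tr (P *m A) + c ->
  0 < e0 -> (forall e, 0 < e < e0 -> pdmx (A + e *: K)) ->
  \tr (P *m K) <= \tr ((logmx A - logmx B) *m K).
Proof.
move=> pA PX PA e00 pK.
(* The remainder is at most [e ^+ 2] times this trace; dividing by [e] leaves an error that vanishes
   with [e]. *)
apply: (@le_of_le_small _ _ (\tr (mxfun (fun x => x^-1) A *m (K *m K))) e0) => //.
move=> e /[dup] /andP[e_gt0 _] /pK pX.
have := PX _ pX; rewrite (relent_pythagoras _ A) PA.
have AVA := mxfun_invK pA; have AAV := mulmx1C AVA.
have := relent_le pX pA.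
set V := mxfun _ A in AVA AAV *.
have -> : \tr (V *m ((A + e *: K) *m (A + e *: K))) =
    \tr A + e * \tr K *+ 2 + e ^+ 2 * \tr (V *m (K *m K)).
  rewrite mulmxDl !mulmxDr !mulmxA AVA !mul1mx !raddfD/=.
  rewrite -!scalemxAr -!scalemxAl !mxtraceZ.
  have -> : \tr (V *m K *m A) = \tr K by rewrite mxtrace_mulC mulmxA AAV mul1mx.
  by ring.
rewrite [A + _ - A]addrAC subrr add0r mulmxDr -!scalemxAr !raddfD/= !mxtraceZ.
set a := \tr (P *m K); set b := \tr (_ *m K); set v := \tr (V *m _).
set r := relent _ A => h1 h2.
rewrite -(ler_pM2l e_gt0); move: h1 h2; lra.
Qed.

(* Lieb's theorem says that [A |-> \tr (expmx (H + logmx A))] is concave; only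
   the existence of a supporting linear functional is needed, and having it
   for every [B] is equivalent. *)
Theorem lieb_supporting_hyperplane H B : H^T = H -> pdmx B ->
  exists Q, (forall A, pdmx A -> \tr (expmx (H + logmx A)) <= \tr (Q *m A)) /\
    \tr (expmx (H + logmx B)) = \tr (Q *m B).
Proof.
move=> Ht pB.
have HL A : pdmx A -> (H + logmx A)^T = H + logmx A.
  by move=> pA; rewrite linearD/= Ht logmx_trmx// pdmx_trmx.
pose X A := expmx (H + logmx A).
have pX A : pdmx A -> pdmx (X A) by move=> pA; exact/expmx_pd/HL.
have lX A : pdmx A -> logmx (X A) = H + logmx A by move=> pA; rewrite expmxK// HL.
have DX A : pdmx A -> relent (X A) A = \tr (H *m X A) - \tr (X A) + \tr A.
  move=> pA; rewrite /relent lX// mulmxDr raddfD/= addrK.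
  by rewrite (mxtrace_mulC (X A)).
have [P [Q [PQ PQ0]]] := relent_tangent (pX _ pB) pB.
have HB : H = logmx (X B) - logmx B by rewrite lX// addrK.
have slope K e0 : 0 < e0 -> (forall e, 0 < e < e0 -> pdmx (X B + e *: K)) ->
    \tr (P *m K) <= \tr (H *m K).
  move=> e00 pK; rewrite [in leRHS]HB.
  apply: (relent_slope (c := \tr (Q *m B)) (pX _ pB) _ PQ0 e00 pK) => Y pY.
  exact: PQ.
(* Moving from [X B] in the direction [- Y] reverses the inequality of [slope]. *)
have PH Y : pdmx Y -> \tr (H *m Y) <= \tr (P *m Y).
  move=> pY; have [e0 e00 h] := pdmx_sub_small (pX _ pB) pY.
  by have := slope _ _ e00 h; rewrite !mulmxN !raddfN/= lerN2.
(* The other inequality comes from the direction [X B] itself, along which positive definiteness is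
   kept. *)
have PHB : \tr (P *m X B) = \tr (H *m X B).
  apply/le_anti/andP; split; last exact/PH/pX.
  apply: (slope _ 1) => // e /andP[e0 _].
  rewrite -[X in X + _]scale1r -scalerDl; apply: pdmx_scale; last exact: pX.
  by rewrite addr_gt0.
(* Write [Y] for [X A]. The tangent inequality [\tr (P Y) + \tr (Q A) <= \tr (H Y) - \tr Y + \tr A]
   and [\tr (H Y) <= \tr (P Y)] give [\tr Y <= \tr ((1 - Q) A)]. *)
exists (1%:M - Q); split => [A pA|].
  have := PQ _ _ (pX _ pA) pA; have := PH _ (pX _ pA).
  rewrite DX// mulmxBl mul1mx raddfB/= -/(X A); lra.
by move: PQ0; rewrite DX// PHB mulmxBl mul1mx raddfB/= -/(X B); lra.
Qed.

End lieb.

(** * Measurability of matrix functions *)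

Lemma cvgn_sum (R : realType) I (r : seq I) (F : I -> nat -> R) (l : I -> R) :
  (forall i, F i n @[n --> \oo] --> l i) ->
  \sum_(i <- r) F i n @[n --> \oo] --> \sum_(i <- r) l i.
Proof.
move=> Fl; elim: r => [|i r IH].
  by rewrite big_nil; under eq_fun do rewrite big_nil; exact: cvg_cst.
by rewrite big_cons; under eq_fun do rewrite big_cons; exact: cvgD.
Qed.

Section measurable_matrix_functions.
Context {R : realType} {dT : measure_display} {T : measurableType dT}.

Lemma measurable_mxP m n (f : T -> 'M[R]_(m, n)) : measurable_fun setT f <->
  forall i j, measurable_fun setT (fun w => f w i j).
Proof.
split=> [mf i j|mf].
  apply: (@measurableT_comp _ _ _ _ _ _ (mx_entry (i, j)) _ f) => //.
  move=> _ B mB; apply: sub_sigma_algebra; exists (i, j) => //.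
  by exists B.
apply: (@measurability _ _ _ _ _ _
  (\bigcup_ij preimage_set_system setT (@mx_entry R m n ij) measurable)) => //.
move=> _ [_ [[i j] _ [B mB <-]] <-].
by rewrite !setTI; have := mf i j measurableT B mB; rewrite setTI.
Qed.

Section square.
Context {d : nat}.
Implicit Types f g : T -> 'M[R]_d.

Lemma measurable_mxD f g : measurable_fun setT f -> measurable_fun setT g ->
  measurable_fun setT (fun w => f w + g w).
Proof.
move=> /measurable_mxP mf /measurable_mxP mg; apply/measurable_mxP => i j.
under eq_fun do rewrite mxE; exact: measurable_funD.
Qed.

Lemma measurable_mxZ (c : R) f : measurable_fun setT f ->
  measurable_fun setT (fun w => c *: f w).
Proof.
move=> /measurable_mxP mf; apply/measurable_mxP => i j.
under eq_fun do rewrite mxE; apply: measurable_funM => //; exact: measurable_cst.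
Qed.

Lemma measurable_mxM f g : measurable_fun setT f -> measurable_fun setT g ->
  measurable_fun setT (fun w => f w *m g w).
Proof.
move=> /measurable_mxP mf /measurable_mxP mg; apply/measurable_mxP => i j.
under eq_fun do rewrite mxE.
by apply: measurable_sum => k; exact: measurable_funM.
Qed.

Lemma measurable_mxT f : measurable_fun setT f ->
  measurable_fun setT (fun w => (f w)^T).
Proof.
move=> /measurable_mxP mf; apply/measurable_mxP => i j.
under eq_fun do rewrite mxE; exact: mf.
Qed.

Lemma measurable_mx_sum I (r : seq I) (F : I -> T -> 'M[R]_d) :
  (forall i, measurable_fun setT (F i)) ->
  measurable_fun setT (fun w => \sum_(i <- r) F i w).
Proof.
move=> mF; apply/measurable_mxP => i j.
under eq_fun do rewrite summxE.
by apply: measurable_sum => k; have /measurable_mxP := mF k; exact.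
Qed.

Lemma measurable_mxtrace f : measurable_fun setT f ->
  measurable_fun setT (fun w => \tr (f w)).
Proof.
move=> /measurable_mxP mf; rewrite /mxtrace.
by apply: measurable_sum => i; exact: mf.
Qed.

Lemma measurable_mxX f n : measurable_fun setT f ->
  measurable_fun setT (fun w => f w ^+ n).
Proof.
move=> mf; elim: n => [|n IH].
  by under eq_fun do rewrite expr0; exact: measurable_cst.
by under eq_fun do rewrite exprS; exact: measurable_mxM.
Qed.

Lemma orthodiagX (A Q : 'M[R]_d) D n : orthodiag A (Q, D) ->
  A ^+ n = Q^T *m diag_mx (map_mx (fun x => x ^+ n) D) *m Q.
Proof.
move=> AQD; have [/= QQ AE] := AQD; rewrite -(mxfunE _ AQD).
have At := orthodiag_trmx AQD.
elim: n => [|n IH].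
  rewrite expr0 (mxfunE _ AQD); have -> : map_mx (fun x => x ^+ 0) D = const_mx 1.
    by apply/rowP => i; rewrite !mxE expr0.
  exact: orthogonal_conj1.
rewrite exprS IH -[X in X * _]mxfun_id// [LHS]mxfunM//.
by congr mxfun; apply/funext => x; rewrite exprS.
Qed.

Lemma cvg_expmx (A : 'M[R]_d) i j : A^T = A ->
  (\sum_(0 <= k < n) (k`!%:R^-1 *: A ^+ k)) i j @[n --> \oo] --> expmx A i j.
Proof.
move=> /symmetric_orthodiag[[Q D] AQD].
have E (v : 'rV[R]_d) :
    (Q^T *m diag_mx v *m Q) i j = \sum_l Q l i * Q l j * v 0 l.
  rewrite mul_mx_diag mxE; apply: eq_bigr => l _.
  by rewrite !mxE; ring.
have -> : (fun n => (\sum_(0 <= k < n) (k`!%:R^-1 *: A ^+ k)) i j) =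
   (fun n => \sum_l Q l i * Q l j * series (exp_coeff (D 0 l)) n).
  apply/funext => n; rewrite summxE.
  under eq_bigr do rewrite mxE (orthodiagX _ AQD) E mulr_sumr.
  rewrite exchange_big/=; apply: eq_bigr => l _.
  rewrite /series/= mulr_sumr; apply: eq_bigr => k _.
  by rewrite mxE /exp_coeff/=; ring.
rewrite /expmx (mxfunE _ AQD) E.
apply: cvgn_sum => l; rewrite mxE; apply: cvgM; first exact: cvg_cst.
exact: is_cvg_series_exp_coeff.
Qed.

(** [mxfun] picks a diagonalization by choice, which gives no measurability; the exponential is
    instead a pointwise limit of polynomials in [f]. *)
Lemma measurable_expmx f : (forall w, (f w)^T = f w) -> measurable_fun setT f ->
  measurable_fun setT (fun w => expmx (f w)).
Proof.
move=> ft mf; apply/measurable_mxP => i j.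
apply: (@measurable_fun_cvg _ _ _ _
  (fun n w => (\sum_(0 <= k < n) (k`!%:R^-1 *: f w ^+ k)) i j)).
  move=> n; apply: (measurable_mxP _).1; apply: measurable_mx_sum => k.
  exact/measurable_mxZ/measurable_mxX.
by move=> w _; exact: cvg_expmx.
Qed.

Lemma mxtrace_expmx (A Q : 'M[R]_d) D (c : R) : orthodiag A (Q, D) ->
  \tr (expmx (c *: A)) = \sum_i expR (c * D 0 i).
Proof.
move=> [/= QQ AE].
have AQD : orthodiag (c *: A) (Q, c *: D).
  split => //=; rewrite AE scalemxAl scalemxAr; congr (_ *m _ *m _).
  by apply/matrixP => i j; rewrite !mxE mulrnAr.
rewrite /expmx (mxfunE _ AQD) mxtrace_mulC mulmxA QQ mul1mx mxtrace_diag.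
by apply: eq_bigr => i _; rewrite !mxE.
Qed.

Lemma psdmx_orthodiag (A Q : 'M[R]_d) D : orthodiag A (Q, D) ->
  psdmx A <-> forall i, 0 <= D 0 i.
Proof.
move=> AQD; split=> [[_ A0] i|D0]; first by rewrite -(orthodiag_row i AQD).
split; first by apply/symmetricmxP; exact: (orthodiag_trmx AQD).
move=> x; rewrite (quad_orthodiag _ AQD) sumr_ge0// => i _.
by rewrite mulr_ge0// sqr_ge0.
Qed.

Lemma pdmx_psdmx (A : 'M[R]_d) : pdmx A -> psdmx A.
Proof.
by move=> [[Q D] [AQD /= D0]]; apply/(psdmx_orthodiag AQD) => i; exact: ltW.
Qed.

(* Countably many conditions on measurable functions of [A]: this is what makes
   the cone of positive semidefinite matrices measurable. *)
Lemma psdmx_expmx (A : 'M[R]_d) : A^T = A ->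
  psdmx A <-> forall k : nat, \tr (expmx (- k%:R *: A)) <= d%:R.
Proof.
move=> /symmetric_orthodiag[[Q D] AQD]; rewrite (psdmx_orthodiag AQD).
split=> [D0 k|Ak i].
  rewrite (mxtrace_expmx _ AQD).
  have -> : d%:R = \sum_(i < d) (1 : R) by rewrite sumr_const card_ord.
  apply: ler_sum => i _; rewrite expR_le1 mulNr oppr_le0.
  by rewrite mulr_ge0.
rewrite leNgt; apply/negP => Di.
(* At a negative eigenvalue, [k] is taken so large that the corresponding exponential alone exceeds
   [d], by [1 + x <= exp x]. *)
have [k] : exists k : nat, d%:R / (- D 0 i) < k%:R.
  by exists (Num.truncn (d%:R / - D 0 i)).+1; rewrite truncnS_gt.
rewrite ltr_pdivrMr ?oppr_gt0// => kD.
have := Ak k; rewrite (mxtrace_expmx _ AQD) leNgt => /negP; apply.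
rewrite (bigD1 i)//=; apply: ltr_wpDr.
  by apply: sumr_ge0 => j _; exact: expR_ge0.
apply: lt_le_trans (expR_ge1Dx _); rewrite mulNr -mulrN.
by rewrite (lt_trans kD)// ltrDr.
Qed.

Lemma measurable_psdmx f : (forall w, (f w)^T = f w) -> measurable_fun setT f ->
  measurable [set w | psdmx (f w)].
Proof.
move=> ft mf.
have -> : [set w | psdmx (f w)] =
    \bigcap_k [set w | \tr (expmx (- k%:R *: f w)) <= d%:R].
  apply/seteqP; split=> [w /= /psdmx_expmx h k _|w h]; first exact: h.
  by apply/psdmx_expmx => // k; exact: h.
apply: bigcapT_measurable => k.
have mg : measurable_fun setT (fun w => \tr (expmx (- k%:R *: f w))).
  apply/measurable_mxtrace/measurable_expmx; last exact: measurable_mxZ.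
  by move=> w; rewrite linearZ/= ft.
rewrite -[X in measurable X]setTI.
have -> : [set w | \tr (expmx (- k%:R *: f w)) <= d%:R] =
   (fun w => \tr (expmx (- k%:R *: f w))) @^-1` `]-oo, d%:R]%classic.
  by apply/seteqP; split=> w /=; rewrite in_itv.
exact: mg.
Qed.

End square.
End measurable_matrix_functions.

(** * Independence *)

Section independence.
Context {R : realType} {dT : measure_display} {T : measurableType dT}.
Variable P : probability T R.
Local Open Scope ereal_scope.

(** Independence makes the joint law the product of the two laws, by uniqueness on measurable
    rectangles; Tonelli then splits the integral. *)
Lemma ge0_integral_independent d1 d2 (E1 : measurableType d1)
    (E2 : measurableType d2) (Y : {RV P >-> E1}) (W : {RV P >-> E2})
    (f : E1 * E2 -> \bar R) :
  (forall B C, measurable B -> measurable C ->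
    P (Y @^-1` B `&` W @^-1` C) = P (Y @^-1` B) * P (W @^-1` C)) ->
  measurable_fun setT f -> (forall z, 0 <= f z) ->
  \int[P]_w f (Y w, W w) = \int[P]_w \int[P]_v f (Y v, W w).
Proof.
move=> indep mf f0.
have mYW : measurable_fun setT (fun w => (Y w, W w)) by exact: measurable_fun_pair.
pose YW : {RV P >-> (E1 * E2)%type} := mfun_Sub (mem_set mYW).
transitivity (\int[distribution P YW]_z f z).
  by rewrite ge0_integral_distribution.
transitivity (\int[distribution P Y \x distribution P W]_z f z).
  apply: eq_measure_integral => A mA _; apply/esym.
  by apply: product_measure_unique => // B C mB mC; rewrite -indep.
rewrite fubini_tonelli2// ge0_integral_distribution//=.
- apply: eq_integral => w _; rewrite /fubini_G/= ge0_integral_distribution//.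
  exact: measurableT_comp.
- exact: measurable_fun_fubini_tonelli_G.
- by move=> y; exact: integral_ge0.
Qed.

Lemma measurable_integral_partial d1 d2 (E1 : measurableType d1)
    (E2 : measurableType d2) (Y : {RV P >-> E1}) (W : {RV P >-> E2})
    (f : E1 * E2 -> \bar R) :
  measurable_fun setT f -> (forall z, 0 <= f z) ->
  measurable_fun setT (fun w => \int[P]_v f (Y v, W w)).
Proof.
move=> mf f0.
have -> : (fun w => \int[P]_v f (Y v, W w)) = fubini_G (distribution P Y) f \o W.
  apply/funext => w; rewrite /= /fubini_G ge0_integral_distribution//.
  exact: measurableT_comp.
apply: measurableT_comp => //; exact: measurable_fun_fubini_tonelli_G.
Qed.

Section mutual.
Context {dE : measure_display} {E : measurableType dE} {I : finType}.
Variable Z : I -> {RV P >-> E}.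
Hypothesis Zindep : mutually_independent Z.

(** Cylinder events: a generating family, stable under intersection, of the sigma-algebra of the
    variables [Z j] with [j] in [J]. *)
Definition rectangles (J : {set I}) : set (set T) :=
  [set A | exists2 B : I -> set E, (forall i, measurable (B i)) &
     A = \bigcap_(i in [set` J]) (Z i @^-1` B i)].

Lemma setI_closed_rectangles J : setI_closed (rectangles J).
Proof.
move=> _ _ [B mB ->] [C mC ->]; exists (fun i => B i `&` C i).
  by move=> i; exact: measurableI.
apply/seteqP; split=> [w [ZB ZC] i iJ|w ZBC].
  by split; [exact: ZB|exact: ZC].
by split=> i iJ; case: (ZBC i iJ).
Qed.

Lemma rectangles_measurable J A : rectangles J A -> measurable A.
Proof.
move=> [B mB ->]; apply: fin_bigcap_measurable => // i _.
exact: measurable_funPTI.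
Qed.

Lemma measurable_rectangles (J : {set I}) j : j \in J ->
  measurable_fun setT (Z j : g_sigma_algebraType (rectangles J) -> E).
Proof.
move=> jJ _ B mB; rewrite setTI; apply: sub_sigma_algebra.
exists (fun i => if i == j then B else setT).
  by move=> i; case: ifP.
apply/seteqP; split=> [w ZB i /= iJ|w /(_ j)/=].
  by case: ifPn => [/eqP ->|].
by rewrite eqxx; exact.
Qed.

(** Both sides are finite measures in [A]; mutual independence makes them agree on the rectangles,
    and agreement on an intersection-stable generating family extends to the sigma-algebra. *)
Lemma independent_g_sigma_algebra (J : {set I}) i (B : set E) (A : set T) :
  i \notin J -> measurable B -> <<s rectangles J >> A ->
  P (Z i @^-1` B `&` A) = P (Z i @^-1` B) * P A.
Proof.
move=> iJ mB.
have mZB : measurable (Z i @^-1` B) by exact: measurable_funPTI.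
have p0 : (0 <= fine (P (Z i @^-1` B)))%R by rewrite fine_ge0.
pose p := NngNum p0.
rewrite setIC => sA.
have -> : P (Z i @^-1` B) * P A = mscale p P A.
  by rewrite /mscale/= fineK// fin_num_measure.
rewrite -/(mrestr P mZB A).
apply: (g_sigma_algebra_measure_unique (rectangles J) _ (fun=> setT)) => //.
- exact: rectangles_measurable.
- move=> _; exists (fun=> setT) => //.
  by apply/esym/seteqP; split.
- by rewrite bigcup_const.
- exact: setI_closed_rectangles.
- move=> _ [C mC ->]; set D := \bigcap_(_ in _) _.
  change (P (D `&` Z i @^-1` B) = (fine (P (Z i @^-1` B)))%:E * P D).
  rewrite fineK ?fin_num_measure// setIC /D.
  pose C' j := if j == i then B else C j.
  have mC' j : measurable (C' j) by rewrite /C'; case: ifP.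
  have := Zindep (i |: J) mC'; rewrite big_setU1//=.
  rewrite {2}/C' eqxx => h.
  have JE j : j \in J -> C' j = C j.
    by rewrite /C'; case: ifPn => // /eqP ->; rewrite (negbTE iJ).
  have -> : P (\bigcap_(j in [set` J]) (Z j @^-1` C j)) =
      \prod_(j in J) P (Z j @^-1` C' j).
    rewrite Zindep//; apply: eq_bigr => j jJ; by rewrite JE.
  rewrite -h; congr (P _); apply/seteqP; split=> w /=.
    move=> [ZB ZC] j /=; rewrite !inE => /orP[/eqP ->|jJ].
      by rewrite /C' eqxx.
    by rewrite JE//; exact: ZC.
  move=> ZC'; split; first by have /= := ZC' i; rewrite /C' eqxx !inE eqxx; exact.
  move=> j /= jJ; rewrite -JE//; apply: ZC'.
  by rewrite /= !inE jJ orbT.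
- move=> k; change (P (setT `&` Z i @^-1` B) < +oo).
  by rewrite setTI -ge0_fin_numE// fin_num_measure.
Qed.

End mutual.

Lemma independent_sum d (I : finType) (Z : I -> {RV P >-> 'M[R]_d})
    (J : {set I}) i (B C : set 'M[R]_d) :
  mutually_independent Z -> i \notin J -> measurable B -> measurable C ->
  P (Z i @^-1` B `&` (fun w => \sum_(j in J) Z j w)%R @^-1` C) =
  P (Z i @^-1` B) * P ((fun w => \sum_(j in J) Z j w)%R @^-1` C).
Proof.
move=> Zindep iJ mB mC.
apply: (independent_g_sigma_algebra Zindep iJ mB).
(* [T'] is [T] with the sigma-algebra generated by the summands only, for which the sum is still
   measurable. *)
pose T' := g_sigma_algebraType (rectangles Z J).
have : measurable_fun setT ((fun w => \sum_(j in J) Z j w)%R : T' -> 'M[R]_d).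
  under eq_fun do rewrite big_mkcond.
  apply: measurable_mx_sum => j; case: (boolP (j \in J)) => jJ.
    exact: measurable_rectangles.
  exact: measurable_cst.
by move=> /(_ measurableT _ mC); rewrite setTI.
Qed.

End independence.

(** * Expectations of matrix exponentials *)

Section expectation_trace.
Context {R : realType} {dT : measure_display} {T : measurableType dT}.
Context {d : nat} (P : probability T R).
Implicit Types (V W : T -> 'M[R]_d) (K : 'M[R]_d).

Lemma mx_integrable_mxtrace K V : mx_integrable P V ->
  P.-integrable setT (fun w => (\tr (K *m V w))%:E).
Proof.
move=> iV; under eq_fun do rewrite tr_mulE -sumEFin.
apply: integrable_sum => // i _; under eq_fun do rewrite -sumEFin.
apply: integrable_sum => // j _; under eq_fun do rewrite EFinM.
exact: integrableZl.
Qed.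

Lemma integral_mxtrace K V : mx_integrable P V ->
  (\int[P]_w (\tr (K *m V w))%:E = (\tr (K *m mx_expectation P V))%:E)%E.
Proof.
move=> iV; rewrite tr_mulE -sumEFin.
have iKV i j : P.-integrable setT (fun w => (K i j * V w j i)%:E).
  by under eq_fun do rewrite EFinM; exact: integrableZl.
under eq_integral do rewrite tr_mulE -sumEFin.
rewrite integral_sum//; last first.
  move=> i; under eq_fun do rewrite -sumEFin; exact: integrable_sum.
apply: eq_bigr => i _; rewrite -sumEFin.
under eq_integral do rewrite -sumEFin.
rewrite integral_sum//; apply: eq_bigr => j _.
under eq_integral do rewrite EFinM.
rewrite integralZl// mxE EFinM fineK ?unlock//.
exact: integrable_fin_num.
Qed.

Lemma mx_integrableD V W : mx_integrable P V -> mx_integrable P W ->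
  mx_integrable P (fun w => V w + W w).
Proof.
move=> iV iW i j; under eq_fun do rewrite mxE EFinD; exact: integrableD.
Qed.

Lemma mx_integrableZ (c : R) V : mx_integrable P V ->
  mx_integrable P (fun w => c *: V w).
Proof.
move=> iV i j; under eq_fun do rewrite mxE EFinM; exact: integrableZl.
Qed.

Lemma mx_integrable_cst K : mx_integrable P (fun=> K).
Proof. by move=> i j; exact: finite_measure_integrable_cst. Qed.

Lemma mx_expectation_trmx V : (forall w, (V w)^T = V w) ->
  (mx_expectation P V)^T = mx_expectation P V.
Proof.
move=> Vt; apply/matrixP => i j; rewrite !mxE; congr (fine ('E_P[_])).
by apply/funext => w; rewrite -[in LHS]Vt mxE.
Qed.

End expectation_trace.

Section exp_moment.
Context {R : realType} {d : nat}.
Implicit Types (A B K : 'M[R]_d).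

Lemma quad_mxtrace A (u : 'rV[R]_d) : (u *m A *m u^T) 0 0 = \tr (u^T *m u *m A).
Proof. by rewrite -[in RHS]mulmxA mxtrace_mulC [in RHS]/mxtrace big_ord1. Qed.

Lemma quad_expmx_ge A (u : 'rV[R]_d) : A^T = A ->
  (u *m (1%:M + A) *m u^T) 0 0 <= (u *m expmx A *m u^T) 0 0.
Proof.
move=> /symmetric_orthodiag[[Q D] AQD].
have [/= QQ _] := AQD.
rewrite mulmxDr mulmxDl mxE (quad_orthodiag _ AQD).
have I1 : orthodiag 1%:M (Q, const_mx 1) := conj QQ (orthogonal_conj1 QQ).
rewrite (quad_orthodiag _ I1).
rewrite (quad_orthodiag _ (orthodiag_mxfun expR AQD)) -big_split/=.
apply: ler_sum => i _; rewrite -mulrDr [const_mx _ _ _]mxE [map_mx _ _ _ _]mxE.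
by rewrite ler_wpM2l ?sqr_ge0// expR_ge1Dx.
Qed.

Context {dT : measure_display} {T : measurableType dT} (P : probability T R).

(* [expmx Y] dominates [1 + Y], whose expectation is the identity. *)
Lemma mx_expectation_expmx_pd (Y : T -> 'M[R]_d) :
  (forall w, (Y w)^T = Y w) -> mx_integrable P Y -> mx_expectation P Y = 0 ->
  mx_integrable P (fun w => expmx (Y w)) ->
  pdmx (mx_expectation P (fun w => expmx (Y w))).
Proof.
move=> Yt iY Y0 iE; apply: pdmx_quad.
  by apply: mx_expectation_trmx => w; rewrite expmx_trmx.
move=> u uu; rewrite quad_mxtrace; apply: (@lt_le_trans _ _ 1) => //.
set K := u^T *m u.
rewrite -lee_fin -integral_mxtrace//.
have -> : (1%:E = \int[P]_w (\tr (K *m (1%:M + Y w)))%:E)%E.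
  under eq_integral do rewrite mulmxDr mulmx1 raddfD/= EFinD.
  rewrite integralD//; [|exact: finite_measure_integrable_cst|
    exact: mx_integrable_mxtrace].
  rewrite integral_mxtrace// Y0 mulmx0 mxtrace0 adde0.
  rewrite (integral_cst _ _ (\tr K)%:E)//= probability_setT mule1.
  by rewrite /K mxtrace_mulC uu mxtrace1.
apply: le_integral => //.
- apply: mx_integrable_mxtrace; apply: mx_integrableD => //.
  exact: mx_integrable_cst.
- exact: mx_integrable_mxtrace.
- by move=> w _; rewrite lee_fin /K -!quad_mxtrace quad_expmx_ge.
Qed.

Lemma mxtrace_expmx_ge0 A : A^T = A -> 0 <= \tr (expmx A).
Proof.
move=> /symmetric_orthodiag[[Q D] AQD].
have := mxtrace_expmx 1 AQD; rewrite scale1r => ->.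
by apply: sumr_ge0 => i _; exact: expR_ge0.
Qed.

(** The functional supporting Lieb's function at [G], evaluated at [expmx (Y w)], majorizes the
    integrand; being linear, it commutes with the expectation and returns the value at [G]. *)
Lemma lieb_jensen (H : 'M[R]_d) (Y : T -> 'M[R]_d) : H^T = H ->
  (forall w, (Y w)^T = Y w) -> measurable_fun setT Y ->
  mx_integrable P (fun w => expmx (Y w)) ->
  let G := mx_expectation P (fun w => expmx (Y w)) in pdmx G ->
  (\int[P]_w (\tr (expmx (H + Y w)))%:E <= (\tr (expmx (H + logmx G)))%:E)%E.
Proof.
move=> Ht Yt mY iE G pG.
have [Q [QA ->]] := lieb_supporting_hyperplane Ht pG.
rewrite -integral_mxtrace//.
have HYt w : (H + Y w)^T = H + Y w by rewrite linearD/= Ht Yt.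
have h w : \tr (expmx (H + Y w)) <= \tr (Q *m expmx (Y w)).
  by rewrite -{1}[Y w]expmxK//; apply/QA/expmx_pd.
have HY0 w := mxtrace_expmx_ge0 (HYt w).
apply: ge0_le_integral => //.
- by move=> w _; rewrite lee_fin.
- apply/measurable_EFinP/measurable_mxtrace/measurable_expmx => //.
  by apply: measurable_mxD => //; exact: measurable_cst.
- by have /measurable_int := mx_integrable_mxtrace Q iE.
- by move=> w _; rewrite lee_fin.
Qed.

End exp_moment.

Section symmetric_part.
Context {R : realType} {d : nat}.
Implicit Types A : 'M[R]_d.

(* On a product space of matrices the argument of [expmx] need not be symmetric;
   composing with [sympart] makes it measurable everywhere. *)
Definition sympart A := 2^-1 *: (A + A^T).

Lemma sympart_trmx A : (sympart A)^T = sympart A.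
Proof. by rewrite /sympart linearZ linearD/= trmxK addrC. Qed.

Lemma sympart_id A : A^T = A -> sympart A = A.
Proof.
move=> At; rewrite /sympart At -[A in A + _]scale1r -[A in _ + A]scale1r.
by rewrite -scalerDl scalerA mulVf ?scale1r.
Qed.

Lemma measurable_sympart (dT : measure_display) (T : measurableType dT)
    (f : T -> 'M[R]_d) :
  measurable_fun setT f -> measurable_fun setT (fun w => sympart (f w)).
Proof.
move=> mf; apply: measurable_mxZ; apply: measurable_mxD => //.
exact: measurable_mxT.
Qed.

End symmetric_part.

(** * Trace exponential moment of an iid sum *)

Section iid_matrices.
Context {R : realType} {dT : measure_display} {T : measurableType dT}.
Context (P : probability T R) {d n : nat}.
Variables (X : 'I_n -> {RV P >-> 'M[R]_d}) (M : 'M[R]_d) (c : R) (i0 : 'I_n).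
Hypothesis Xsym : forall i w, (X i w)^T = X i w.
Hypothesis Xiid : iid X.
Hypothesis Xint : mx_integrable P (X i0).
Hypothesis Xmean : mx_expectation P (X i0) = M.
Hypothesis Gint : mx_integrable P (fun w => expmx (c *: (X i0 w - M))).

Let G := centered_mgf P (X i0) M c.

Let Mt : M^T = M.
Proof. by rewrite -Xmean mx_expectation_trmx. Qed.

Let Yt i w : (c *: (X i w - M))^T = c *: (X i w - M).
Proof. by apply/symZ/symB. Qed.

(** Centering gives the exponent mean zero, as [mx_expectation_expmx_pd] requires; [logmx G] is
    thereby a genuine logarithm. *)
Lemma centered_mgf_pd : pdmx G.
Proof.
apply: mx_expectation_expmx_pd => //.
  by apply/mx_integrableZ/mx_integrableD => //; exact: mx_integrable_cst.
have ME i j : (M i j)%:E = (\int[P]_w (X i0 w i j)%:E)%E.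
  by rewrite -Xmean mxE unlock fineK//; exact: integrable_fin_num.
apply/matrixP => i j; rewrite !mxE unlock.
under eq_integral do rewrite !mxE EFinM EFinD.
rewrite integralZl//; last first.
  by apply: integrableD => //; exact: finite_measure_integrable_cst.
rewrite integralD//; last exact: finite_measure_integrable_cst.
rewrite -ME (integral_cst _ _ (- M i j)%:E)//= probability_setT mule1.
by rewrite -EFinD subrr mule0.
Qed.

(** The integral depends on [X k] only through its law, so [X k] can be traded for [X i0], from
    which [G] is defined. *)
Lemma lieb_jensen_iid (H : 'M[R]_d) k : H^T = H ->
  (\int[P]_w (\tr (expmx (H + c *: (X k w - M))))%:E <=
   (\tr (expmx (H + logmx G)))%:E)%E.
Proof.
move=> Ht.
pose g (x : 'M[R]_d) := (\tr (expmx (H + c *: (sympart x - M))))%:E.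
have gt (x : 'M[R]_d) :
    (H + c *: (sympart x - M))^T = H + c *: (sympart x - M).
  by apply: symD => //; apply/symZ/symB; rewrite ?sympart_trmx.
have mg : measurable_fun setT g.
  apply/measurable_EFinP/measurable_mxtrace/measurable_expmx => //.
  apply: measurable_mxD; first exact: measurable_cst.
  apply: measurable_mxZ; apply: measurable_mxD; last exact: measurable_cst.
  exact: measurable_sympart.
have g0 x : (0 <= g x)%E by rewrite lee_fin mxtrace_expmx_ge0.
have gX j : (\int[P]_w (\tr (expmx (H + c *: (X j w - M))))%:E =
             \int[distribution P (X j)]_x g x)%E.
  rewrite (ge0_integral_distribution (X j) mg g0); apply: eq_integral => w _ /=.
  by rewrite /g sympart_id.
rewrite gX (eq_measure_integral (distribution P (X i0))); last first.
  by move=> A mA _; exact: Xiid.2.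
rewrite -gX; apply: lieb_jensen => //.
- apply: measurable_mxZ; apply: measurable_mxD => //; exact: measurable_cst.
- exact: centered_mgf_pd.
Qed.

Definition partial_sum (k : nat) (w : T) : 'M[R]_d :=
  \sum_(j in [set j : 'I_n | (j < k)%N]%SET) X j w.

Lemma measurable_partial_sum k : measurable_fun setT (partial_sum k).
Proof.
rewrite /partial_sum; under eq_fun do rewrite big_mkcond.
apply: measurable_mx_sum => j; case: (j \in _) => //; exact: measurable_cst.
Qed.

Lemma partial_sum_trmx k w : (partial_sum k w)^T = partial_sum k w.
Proof. by rewrite /partial_sum linear_sum/=; apply: eq_bigr => j _; exact: Xsym. Qed.

Let L := logmx G.

Let Lt : L^T = L.
Proof. exact/logmx_trmx/pdmx_trmx/centered_mgf_pd. Qed.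

(** Interpolation: the first [k] terms of the exponent are still random, the other [n - k] are
    replaced by [logmx G]. It runs from the bound at [k = 0] to the moment at [k = n]. *)
Let F (k : nat) : \bar R :=
  (\int[P]_w (\tr (expmx (c *: (partial_sum k w - k%:R *: M) +
                          (n - k)%:R *: L)))%:E)%E.

(** Given the first [k] matrices, [lieb_jensen_iid] applies to the next one, independent of them,
    with everything else in the exponent as [H]. *)
Let FS k : (k < n)%N -> (F k.+1 <= F k)%E.
Proof.
move=> kn; pose i := Ordinal kn.
pose f (z : 'M[R]_d * 'M[R]_d) : \bar R :=
  (\tr (expmx (sympart (c *: (z.2 - k%:R *: M) + (n - k.+1)%:R *: L +
                        c *: (z.1 - M)))))%:E.
have mf : measurable_fun setT f.
  apply/measurable_EFinP/measurable_mxtrace/measurable_expmx.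
    by move=> z; exact: sympart_trmx.
  apply: measurable_sympart; apply: measurable_mxD; last first.
    apply: measurable_mxZ; apply: measurable_mxD; last exact: measurable_cst.
    exact: measurable_fst.
  apply: measurable_mxD; last exact: measurable_cst.
  apply: measurable_mxZ; apply: measurable_mxD; last exact: measurable_cst.
  exact: measurable_snd.
have f0 z : (0 <= f z)%E by rewrite lee_fin mxtrace_expmx_ge0// sympart_trmx.
pose S : {RV P >-> 'M[R]_d} := mfun_Sub (mem_set (measurable_partial_sum k)).
have Ht w : (c *: (partial_sum k w - k%:R *: M) + (n - k.+1)%:R *: L)^T =
    c *: (partial_sum k w - k%:R *: M) + (n - k.+1)%:R *: L.
  by apply: symD; apply: symZ => //; apply: symB; rewrite ?partial_sum_trmx ?symZ.
have fE v w : f (X i v, S w) = (\tr (expmx (c *: (partial_sum k w - k%:R *: M) +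
    (n - k.+1)%:R *: L + c *: (X i v - M))))%:E.
  by rewrite /f /= sympart_id// symD.
have sumS w : partial_sum k.+1 w = X i w + partial_sum k w.
  rewrite /partial_sum (bigD1 i)/=; last by rewrite inE/= ltnSn.
  congr (_ + _); apply: eq_bigl => j; rewrite !inE ltnS -val_eqE/=.
  by rewrite ltn_neqAle andbC.
rewrite /F.
have -> : (\int[P]_w (\tr (expmx (c *: (partial_sum k.+1 w - k.+1%:R *: M) +
    (n - k.+1)%:R *: L)))%:E = \int[P]_w f (X i w, S w))%E.
  apply: eq_integral => w _; rewrite fE; congr (_%:E); congr (\tr (expmx _)).
  rewrite sumS -natr1 scalerDl scale1r [RHS]addrAC -[in RHS]scalerDr; congr (c *: _ + _).
  by rewrite [X in X - _]addrC opprD addrACA.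
rewrite ge0_integral_independent//; last first.
  move=> B C mB mC; apply: (independent_sum Xiid.1 _ mB mC).
  by rewrite inE ltnn.
have mG w : (0 <= \int[P]_v f (X i v, S w))%E by exact: integral_ge0.
have H0 w : (c *: (partial_sum k w - k%:R *: M) + (n - k)%:R *: L)^T =
    c *: (partial_sum k w - k%:R *: M) + (n - k)%:R *: L.
  by apply: symD; apply: symZ => //; apply: symB; rewrite ?partial_sum_trmx ?symZ.
apply: ge0_le_integral => //.
- exact: measurable_integral_partial.
- apply/measurable_EFinP/measurable_mxtrace/measurable_expmx => //.
  apply: measurable_mxD; last exact: measurable_cst.
  apply: measurable_mxZ; apply: measurable_mxD; last exact: measurable_cst.
  exact: measurable_partial_sum.
- move=> w _; under eq_integral do rewrite fE.
  apply: (le_trans (lieb_jensen_iid i (Ht w))).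
  (* The new copy of [L] joins the [n - k.+1] present ones; [k < n] makes the truncated difference
     come out as [n - k]. *)
  by rewrite -addrA -/L -{2}[L]scale1r -scalerDl natr1 -subSn// subSS.
Qed.

Theorem expectation_mxtrace_expmx_iid :
  (\int[P]_w (\tr (expmx (c *: (\sum_i X i w - n%:R *: M))))%:E <=
   (\tr (expmx (n%:R *: logmx G)))%:E)%E.
Proof.
have -> : (\int[P]_w (\tr (expmx (c *: (\sum_i X i w - n%:R *: M))))%:E = F n)%E.
  apply: eq_integral => w _; rewrite subnn scale0r addr0 /partial_sum.
  do 5 f_equal; apply: eq_bigl => j; by rewrite inE ltn_ord.
have F0 : F 0 = (\tr (expmx (n%:R *: logmx G)))%:E.
  rewrite /F /partial_sum.
  under eq_integral => w _.
    rewrite big1; last by move=> j; rewrite inE.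
    rewrite scale0r subrr scaler0 add0r subn0; over.
  by rewrite integral_cst//= probability_setT mule1.
have FF k : (k <= n)%N -> (F k <= F 0)%E.
  elim: k => [_|k IH kn]; first exact: lexx.
  exact: (le_trans (FS kn) (IH (ltnW kn))).
by rewrite -F0 FF.
Qed.

End iid_matrices.

(** * Tail bound with a super-uniform threshold *)

Theorem theorem3p5 (R : realType) (dT : measure_display)
  (T : measurableType dT) (P : probability T R)
  (d n : nat) (hd : (0 < d)%N) (hn : (0 < n)%N)
  (X : 'I_n -> {RV P >-> 'M[R]_d}) (U : {RV P >-> 'M[R]_d}) (M : 'M[R]_d)
  (Xsym : forall i w, X i w \is symmetricmx)
  (Xiid : iid X)
  (Xint : mx_integrable P (X (Ordinal hn)))
  (Xmean : mx_expectation P (X (Ordinal hn)) = M)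
  (Usu : super_uniform P U)
  (* X_1, ..., X_n, U are mutually independent *)
  (XUindep : mutually_independent (oapp X U))
  (gamma beta : R) (hgamma : 0 < gamma) (hbeta : 0 < beta)
  (* the expectation defining G (gamma / n) exists *)
  (Gint : mx_integrable P
     (fun w => expmx ((gamma / n%:R) *: (X (Ordinal hn) w - M)))) :
  let G := centered_mgf P (X (Ordinal hn)) M in
  let Xbar := fun w => n%:R^-1 *: \sum_(i < n) X i w in
  (P [set w | loewner_le (beta *: U w) (expmx (gamma *: (Xbar w - M)))]
   <= ((beta * d%:R)^-1
       * \tr (expmx (n%:R *: logmx (G (gamma / n%:R)))))%:E)%E.
Proof.
cbv zeta; set Xbar := fun w => n%:R^-1 *: \sum_(i < n) X i w.
have Xt i w : (X i w)^T = X i w by apply/symmetricmxP.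
have Mt : M^T = M by rewrite -Xmean mx_expectation_trmx.
have [Upsd Usu'] := Usu.
have Ut w : (U w)^T = U w by apply/symmetricmxP; case: (Upsd w).
have n0 : n%:R != 0 :> R by rewrite pnatr_eq0 -lt0n.
pose S w := \sum_i X i w.
have mS : measurable_fun setT S by exact: measurable_mx_sum.
have St w : (S w)^T = S w by rewrite linear_sum/=; apply: eq_bigr.
pose SR : {RV P >-> 'M[R]_d} := mfun_Sub (mem_set mS).
(* In terms of the sum instead of the mean, the parameter becomes [gamma / n], at which [G] is
   evaluated. *)
pose V t : 'M[R]_d := (gamma / n%:R) *: (t - n%:R *: M).
have VE w : gamma *: (Xbar w - M) = V (S w).
  by rewrite /V -scalerA [n%:R^-1 *: _]scalerBr [_ *: (_ *: M)]scalerA mulVf// scale1r.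
have Vt t : t^T = t -> (V t)^T = V t.
  by move=> tt; apply/symZ/symB => //; exact: symZ.
(* The event becomes a condition on a pair, with [z.1] standing for [U] and [z.2] for the sum, so
   that it can be integrated over a product. *)
pose D (z : 'M[R]_d * 'M[R]_d) :=
  sympart (expmx (sympart (V z.2)) - beta *: z.1).
have mD : measurable [set z | psdmx (D z)].
  apply: measurable_psdmx; first by move=> z; exact: sympart_trmx.
  apply: measurable_sympart; apply: measurable_mxD; last first.
    under eq_fun do rewrite -scaleNr.
    by apply: measurable_mxZ; exact: measurable_fst.
  apply: measurable_expmx; first by move=> z; exact: sympart_trmx.
  apply: measurable_sympart; apply: measurable_mxZ; apply: measurable_mxD.
    exact: measurable_snd.
  exact: measurable_cst.
have DE v w : D (U v, SR w) = expmx (V (S w)) - beta *: U v.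
  have VSt := Vt _ (St w).
  rewrite /D /= sympart_id; rewrite (sympart_id VSt)//.
  by apply: symB; [exact: expmx_trmx|exact: symZ].
pose f z : \bar R := (\1_[set z | psdmx (D z)] z)%:E.
have mf : measurable_fun setT f by exact/measurable_EFinP/measurable_indic.
have f0 z : (0 <= f z)%E by rewrite lee_fin.
have mUw (g : T -> 'M[R]_d * 'M[R]_d) : measurable_fun setT g ->
    measurable [set w | psdmx (D (g w))].
  by move=> mg; rewrite -[X in measurable X]setTI; exact: (mg measurableT _ mD).
have -> : P [set w | loewner_le (beta *: U w) (expmx (gamma *: (Xbar w - M)))] =
    (\int[P]_w f (U w, SR w))%E.
  have -> : [set w | loewner_le (beta *: U w) (expmx (gamma *: (Xbar w - M)))] =
      [set w | psdmx (D (U w, SR w))].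
    by apply/seteqP; split=> w; rewrite /= /loewner_le VE DE.
  rewrite -[X in P X]setIT -integral_indic//.
  by apply: mUw; exact: measurable_fun_pair.
rewrite ge0_integral_independent//; last first.
  move=> B C mB mC.
  (* In the joint family [U] has index [None] and the summands have the indices [Some j]. *)
  pose J : {set option 'I_n} := [set Some j | j in 'I_n]%SET.
  have SE : SR = (fun w => \sum_(j in J) oapp X U j w) :> (T -> 'M[R]_d).
    apply/funext => w; rewrite /J big_imset/=; last by move=> ? ? _ _ [].
    by change (S w = \sum_(i in 'I_n) X i w); exact: eq_bigl.
  have NJ : None \notin J by apply/imsetP => -[].
  have := independent_sum XUindep NJ mB mC.
  by rewrite -SE.
have trV0 w : 0 <= \tr (expmx (V (S w))) by apply/mxtrace_expmx_ge0/Vt.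
have mtrV : measurable_fun setT (fun w => (\tr (expmx (V (S w))))%:E).
  apply/measurable_EFinP/measurable_mxtrace/measurable_expmx.
    by move=> w; exact/Vt.
  apply: measurable_mxZ; apply: measurable_mxD => //; exact: measurable_cst.
(* For a fixed value of the sum, the event says that [U] lies below [beta^-1 *: expmx (V (S w))];
   super-uniformity bounds its probability by the trace of that matrix over [d]. *)
apply: (@le_trans _ _
    (\int[P]_w (((beta * d%:R)^-1)%:E * (\tr (expmx (V (S w))))%:E))%E).
  apply: ge0_le_integral => //.
  - by move=> w _; exact: integral_ge0.
  - exact: measurable_integral_partial.
  - exact: measurable_funeM.
  - move=> w _.
    have pZ : psdmx (beta^-1 *: expmx (V (S w))).
      by apply: psdmx_scale; [rewrite invr_gt0|exact/pdmx_psdmx/expmx_pd/Vt/St].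
    have -> : (\int[P]_v f (U v, SR w) =
        P [set v | loewner_le (U v) (beta^-1 *: expmx (V (S w)))])%E.
      have -> : [set v | loewner_le (U v) (beta^-1 *: expmx (V (S w)))] =
          [set v | psdmx (D (U v, SR w))].
        have UE v : beta^-1 *: expmx (V (S w)) - U v = beta^-1 *: D (U v, SR w).
          by rewrite DE scalerBr scalerA mulVf ?scale1r// lt0r_neq0.
        apply/seteqP; split=> v; rewrite /= /loewner_le UE; last first.
          by apply: psdmx_scale; rewrite invr_gt0.
        by move=> /(psdmx_scale hbeta); rewrite scalerA mulfV ?scale1r// lt0r_neq0.
      rewrite -[X in P X]setIT -integral_indic//.
      by apply: mUw; apply: measurable_fun_pair => //; exact: measurable_cst.
    apply: (le_trans (Usu' _ pZ)); rewrite -EFinM lee_fin linearZ/=.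
    by rewrite invfM mulrAC.
rewrite ge0_integralZl_EFin//; last 2 first.
- by move=> w _; rewrite lee_fin.
- by rewrite invr_ge0 mulr_ge0// ltW.
rewrite EFinM; apply: lee_wpmul2l.
  by rewrite lee_fin invr_ge0 mulr_ge0// ltW.
exact: (expectation_mxtrace_expmx_iid Xt Xiid Xint Xmean Gint).
Qed.
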